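(* Work in the standing setting described in the context (problem, discretization, and the five structural hypotheses ''Inclusion'', ''Discrete inf-sup'', ''Local approximation operator'', ''Discrete curl decomposition'', ''A posteriori estimate''). Then there exists a constant $C_0>0$, independent of the meshes, such that the following holds. Given $f\in L^2(\Omega)$, let $(\sigma,u)$ be the exact solution, and let $(\sigma_h,u_h)$ and $(\sigma_H,u_H)$ be the solutions of the discrete problem over nested triangulations $\mathcal T_h$ and $\mathcal T_H$, where $\mathcal T_h$ is a refinement of $\mathcal T_H$. Then $$(\mathcal A(\sigma-\sigma_h),\sigma_h-\sigma_H)_{L^2(\Omega)}\le\sqrt{C_0}\,\|\sigma-\sigma_h\|_{\mathcal A}\operatorname{osc}(f,\mathcal T_H\setminus\mathcal T_h),$$ and thus, for any $\delta>0$, $$(1-\delta)\|\sigma-\sigma_h\|^2_{\mathcal A}\le\|\sigma-\sigma_H\|^2_{\mathcal A}-\|\sigma_h-\sigma_H\|^2_{\mathcal A}+\frac{C_0}{\delta}\operatorname{osc}^2(f,\mathcal T_H\setminus\mathcal T_h).$$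
   Context: **Continuous problem.** $\Omega\subset\mathbb R^d$ ($d=2,3$) is a simply connected bounded domain (that admits simplicial triangulations), $n\ge1$ an integer, $\Sigma:=H(\operatorname{div},\Omega;\mathbb R^{d\times n})$ (or, as in the Stokes case, its closed subspace of fields with mean-zero trace), $U:=L^2(\Omega;\mathbb R^n)$; $\operatorname{div},\operatorname{rot},\operatorname{curl}$ and tangential components act on each of the $n$ $\mathbb R^d$-valued rows. $\mathcal A$ is a linear, bounded, symmetric positive semi-definite operator on $L^2$ with, for all $\tau\in\Sigma$, $0\le(\mathcal A\tau,\tau)_{L^2(\Omega)}\le C\|\tau\|_{L^2(\Omega)}^2$ and $\|\tau\|^2_{L^2(\Omega)}\le C\big((\mathcal A\tau,\tau)_{L^2(\Omega)}+\|\operatorname{div}\tau\|^2_{H^{-1}(\Omega)}\big)$, where $\|\psi\|_{H^{-1}(\Omega)}=\sup_{v\in H^1_0(\Omega)}(\psi,v)/\|v\|_{H^1(\Omega)}$. Write $\|\tau\|_{\mathcal A}:=(\mathcal A\tau,\tau)^{1/2}_{L^2(\Omega)}$. Given $f\in L^2(\Omega)$, the exact solution $(\sigma,u)\in\Sigma\times U$ satisfies $(\mathcal A\sigma,\tau)-(\operatorname{div}\tau,u)=0$ for all $\tau\in\Sigma$ and $(\operatorname{div}\sigma,v)=(f,v)$ for all $v\in U$. **Discretization.** Triangulations are conforming, simplicial and uniformly shape-regular; $\mathcal E_h$ is the set of edges ($d=2$) or faces ($d=3$) of $\mathcal T_h$; $h_K:=|K|^{1/d}$, $h_E:=|E|^{1/(d-1)}$;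 elements are closed sets. $[\cdot]|_E$ is the jump across an interior $E$, and the trace itself for boundary $E$; $\nu_E$ is a unit normal, $t_E$ (for $d=2$) a unit tangent. To each $\mathcal T_h$ are attached piecewise polynomial finite element spaces $\Sigma_h\subset\Sigma$, $U_h\subset U$, $H_h(\operatorname{curl},\Omega)\subset H(\operatorname{curl},\Omega)$; $U_h$ is elementwise defined without interelement continuity and is nested under refinement; $\mathcal A$ maps $\Sigma_h$ into piecewise polynomials. The discrete solution $(\sigma_h,u_h)\in\Sigma_h\times U_h$ satisfies $(\mathcal A\sigma_h,\tau_h)-(\operatorname{div}\tau_h,u_h)=0$ for all $\tau_h\in\Sigma_h$ and $(\operatorname{div}\sigma_h,v_h)=(f,v_h)$ for all $v_h\in U_h$. If $\mathcal T_h$ is a refinement of $\mathcal T_H$, the objects on $\mathcal T_H$ carry the index $H$, $\mathcal R:=\mathcal T_H\setminus\mathcal T_h$, and $\tilde{\mathcal R}:=\{K\in\mathcal T_H: K\cap K'\ne\emptyset\text{ for some }K'\in\mathcal R\}$. **Curl, rot.** For $d=2$: $\operatorname{curl}v=(\partial_2v,-\partial_1v)^T$, $\operatorname{rot}\beta=\partial_2\beta_1-\partial_1\beta_2$; for $d=3$: $\operatorname{curl}\beta=\nabla\times\beta$. **Estimator and oscillation.** For $\mathcal M_h\subseteq\mathcal T_h$: if $d=2$, $\eta^2(\sigma_h,\mathcal M_h):=\sum_{K\in\mathcal M_h}\big(\|h_K\operatorname{rot}(\mathcal A\sigma_h)\|^2_{L^2(K)}+\sum_{E\in\mathcal E_h,E\subset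 K}\|h_E^{1/2}[\mathcal A\sigma_h\cdot t_E]\|^2_{L^2(E)}\big)$; if $d=3$, replace $\operatorname{rot}$ by $\operatorname{curl}$ and $\mathcal A\sigma_h\cdot t_E$ by $\mathcal A\sigma_h\times\nu_E$. With $f_h:=\mathcal Q_hf$ the $L^2$-projection of $f$ onto $U_h$, $\operatorname{osc}^2(f,\mathcal M_h):=\sum_{K\in\mathcal M_h}\|h_K(f-f_h)\|^2_{L^2(K)}$ (for $\mathcal M\subseteq\mathcal T_H$ one uses $f_H$). **Discrete norm.** $\|v_h\|_{1,h,G}^2:=\sum_{K\in\mathcal T_h,K\subset G}\|\nabla v_h\|^2_{L^2(K)}+\sum_{E\in\mathcal E_h,E\subset G}h_E^{-1}\|[v_h]\|^2_{L^2(E)}$, and $\|\cdot\|_{1,h}:=\|\cdot\|_{1,h,\Omega}$. **Structural hypotheses** ($a\lesssim b$ means $a\le Cb$ with $C$ independent of the meshes; $\mathcal T_h$ is any refinement of $\mathcal T_H$). - *Inclusion*: $\Sigma_H\subset\Sigma_h$ and $\operatorname{div}\Sigma_h\subset U_h$. - *Discrete inf-sup*: $\|v_h\|_{1,h}\lesssim\sup_{0\ne\tau_h\in\Sigma_h}(\operatorname{div}\tau_h,v_h)_{L^2(\Omega)}/\|\tau_h\|_{L^2(\Omega)}$ for all $v_h\in U_h$. - *Local approximation operator*: there is $\mathcal S_H:U_h\to U_H$ with $\mathcal S_Hv_h|_K=v_h|_K$ for $K\in\mathcal T_H\cap\mathcal T_h$ and $\|v_h-\mathcal S_Hv_h\|_{L^2(K)}\lesssim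 h_K\|v_h\|_{1,h,D_K}$ for $K\in\mathcal T_H\setminus\mathcal T_h$, where $D_K=\bigcup\{K'\in\mathcal T_h:K'\cap K\neq\emptyset\}$. - *Discrete curl decomposition*: for $\xi_h\in\Sigma_h$ with $\operatorname{div}\xi_h=0$ there are $\varphi_h\in H_h(\operatorname{curl},\Omega)$ and an operator $\Pi_H:H_h(\operatorname{curl},\Omega)\to H_H(\operatorname{curl},\Omega)$ with $\xi_h=\operatorname{curl}\varphi_h$, $\operatorname{curl}\Pi_H\varphi_h\in\Sigma_H$, and there are $\psi\in H^1(\Omega)$, $\phi\in L^2(\Omega)$ with $\operatorname{curl}(\varphi_h-\Pi_H\varphi_h)=\operatorname{curl}\psi+\phi$, $(\mathcal A\sigma_H,\phi)_{L^2(\Omega)}=0$ (with $(\sigma_H,u_H)$ the discrete solution over $\mathcal T_H$), $\psi|_K=0$ for $K\in\mathcal T_H\setminus\tilde{\mathcal R}$, $\big(\sum_{K\in\mathcal T_H}\|h_K^{-1}\psi\|_{L^2(K)}^2\big)^{1/2}\lesssim\|\operatorname{curl}\varphi_h\|_{L^2(\Omega)}$ and $\big(\sum_{E\in\mathcal E_H}\|h_E^{-1/2}\psi\|_{L^2(E)}^2\big)^{1/2}\lesssim\|\operatorname{curl}\varphi_h\|_{L^2(\Omega)}$. - *A posteriori estimate*: there are constants $C_{Rel},C_{Eff}>0$ depending only on shape regularity with $\|\sigma-\sigma_h\|^2_{\mathcal A}\le C_{Rel}(\eta^2(\sigma_h,\mathcal T_h)+\operatorname{osc}^2(f,\mathcal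 T_h))$ and $C_{Eff}\,\eta^2(\sigma_h,\mathcal T_h)\le\|\sigma-\sigma_h\|^2_{\mathcal A}$. *)

(* Defs.v *)
From HB Require Import structures.
From mathcomp Require Import all_boot all_order all_algebra finmap.
From mathcomp Require Import all_classical all_reals all_analysis.
From mathcomp Require mpoly.
Import Order.TTheory GRing.Theory Num.Theory.
Import numFieldNormedType.Exports.

Set Implicit Arguments.
Unset Strict Implicit.
Unset Printing Implicit Defensive.

Local Open Scope classical_set_scope.
Local Open Scope ring_scope.

(* The sigma-algebra of R^d generated by the coordinates, which is the Borel
   one. *)
Definition rV_display : measure_display. Proof. exact. Qed.

Section measurable_rV.
Context {R : realType} (d : nat).

Let coors : 'I_d -> 'rV[R]_d -> R := fun i x => x ord0 i.

Let rV_set0 : g_sigma_preimage coors set0.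
Proof. exact: sigma_algebra0. Qed.

Let rV_setC A : g_sigma_preimage coors A -> g_sigma_preimage coors (~` A).
Proof. exact: sigma_algebraC. Qed.

Let rV_bigcup (F : (set 'rV[R]_d)^nat) : (forall i, g_sigma_preimage coors (F i)) ->
  g_sigma_preimage coors (\bigcup_i (F i)).
Proof. exact: sigma_algebra_bigcup. Qed.

HB.instance Definition _ := @isMeasurable.Build rV_display
  'rV[R]_d (g_sigma_preimage coors) rV_set0 rV_setC rV_bigcup.

Lemma measurable_coord (i : 'I_d) :
  measurable_fun [set: 'rV[R]_d] (fun x : 'rV[R]_d => x ord0 i).
Proof.
move=> _ Y mY; rewrite setTI; apply: sub_sigma_algebra => /=.
rewrite -bigcup_seq/=; exists i => /=; first by rewrite mem_index_enum.
by exists Y => //; rewrite setTI.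
Qed.

Lemma measurable_fun_coordP d1 (T1 : measurableType d1) (f : T1 -> 'rV[R]_d) :
  (forall i, measurable_fun [set: T1] (fun t => f t ord0 i)) ->
  measurable_fun [set: T1] f.
Proof.
move=> mf.
have H : g_sigma_preimage (fun i => coors i \o f) `<=` measurable.
  apply: smallest_sub; first exact: sigma_algebra_measurable.
  rewrite -bigcup_seq; apply: bigcup_sub => i _ A [B mB <-].
  exact: mf.
move=> _ A mA; apply: H; rewrite g_sigma_preimage_comp; by exists A.
Qed.

End measurable_rV.

Section lebesgue_rV.
Context {R : realType}.

Definition cons_rV (d : nat) (p : R * 'rV[R]_d) : 'rV[R]_d.+1 :=
  \row_i oapp (p.2 ord0) p.1 (unlift ord0 i).

Definition uncons_rV (d : nat) (x : 'rV[R]_d.+1) : R * 'rV[R]_d :=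
  (x ord0 ord0, \row_i x ord0 (lift ord0 i)).

Lemma cons_rVK d : cancel (@cons_rV d) (@uncons_rV d).
Proof.
move=> [a x]; rewrite /uncons_rV mxE unlift_none; congr (_, _).
by apply/rowP => i; rewrite !mxE liftK.
Qed.

Lemma measurable_cons_rV d : measurable_fun setT (@cons_rV d).
Proof.
apply: measurable_fun_coordP => i.
case: (unliftP ord0 i) => [j|] ->.
  rewrite (_ : (fun t => _) = (fun x : 'rV[R]_d => x ord0 j) \o snd).
    by apply: measurableT_comp => //; exact: measurable_coord.
  by apply/funext => t /=; rewrite mxE liftK.
rewrite (_ : (fun t => _) = fst) //.
by apply/funext => t /=; rewrite mxE unlift_none.
Qed.

Lemma measurable_uncons_rV d : measurable_fun setT (@uncons_rV d).
Proof.
apply: measurable_fun_pair; first exact: measurable_coord.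
apply: measurable_fun_coordP => i /=.
rewrite (_ : (fun t => _) = (fun x : 'rV[R]_d.+1 => x ord0 (lift ord0 i))).
  exact: measurable_coord.
by apply/funext => x; rewrite mxE.
Qed.

Section step.
Local Open Scope ereal_scope.
Context (d : nat) (mu : {sigma_finite_measure set 'rV[R]_d -> \bar R}).

Definition leb_step : set 'rV[R]_d.+1 -> \bar R :=
  pushforward (@lebesgue_measure R \x mu) (@cons_rV d).

Let leb_step0 : leb_step set0 = 0.
Proof. by rewrite /leb_step /pushforward preimage_set0 measure0. Qed.

Let leb_step_ge0 A : 0 <= leb_step A.
Proof. by rewrite /leb_step /pushforward; exact: measure_ge0. Qed.

Let leb_step_sigma_additive : semi_sigma_additive leb_step.
Proof.
move=> F mF tF mUF; rewrite /leb_step /pushforward preimage_bigcup.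
apply: measure_semi_sigma_additive.
- by move=> n; rewrite -[X in measurable X]setTI; exact: measurable_cons_rV.
- apply/trivIsetP => /= i j _ _ ij; rewrite -preimage_setI.
  by move/trivIsetP : tF => /(_ _ _ _ _ ij) ->//; rewrite preimage_set0.
- rewrite -preimage_bigcup -[X in measurable X]setTI.
  exact: measurable_cons_rV.
Qed.

HB.instance Definition _ := isMeasure.Build _ _ _ leb_step
  leb_step0 leb_step_ge0 leb_step_sigma_additive.

Let leb_step_sigma_finite : sigma_finite setT leb_step.
Proof.
have /sigma_finiteP[F [TF ndF Foo]] := sigma_finiteT (@lebesgue_measure R).
have /sigma_finiteP[G [TG ndG Goo]] := sigma_finiteT mu.
exists (fun k => @uncons_rV d @^-1` (F k `*` G k)).
  rewrite -preimage_bigcup (_ : \bigcup_k _ = setT) ?preimage_setT//.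
  rewrite -subTset => -[x y] _.
  have [n _ Fnx] : (\bigcup_k F k) x by rewrite -TF.
  have [k _ Gky] : (\bigcup_k G k) y by rewrite -TG.
  exists (maxn n k) => //; split.
    by move: x Fnx; exact/subsetPset/ndF/leq_maxl.
  by move: y Gky; exact/subsetPset/ndG/leq_maxr.
move=> k; have [mF Fk] := Foo k; have [mG Gk] := Goo k; split.
  rewrite -[X in measurable X]setTI; apply: measurable_uncons_rV => //.
  exact: measurableX.
rewrite /leb_step /pushforward -comp_preimage (_ : _ \o _ = id); last first.
  by apply/funext => p /=; exact: cons_rVK.
by rewrite preimage_id product_measure1E// lte_mul_pinfty// ge0_fin_numE.
Qed.

HB.instance Definition _ := Measure_isSigmaFinite.Build _ _ _ leb_step
  leb_step_sigma_finite.

End step.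

Fixpoint leb (d : nat) : {sigma_finite_measure set 'rV[R]_d -> \bar R} :=
  if d is d'.+1 then leb_step (leb d') else \d_(0 : 'rV[R]_0).

End lebesgue_rV.

(* Fields on R^d with values in R^{n x q}; the n rows are the n vectors on
   which div, rot, curl and tangential components act. *)
Definition mfield (R : realType) (d n q : nat) := 'rV[R]_d -> 'M[R]_(n, q).

Section fields.
Context {R : realType} {d : nat}.
Implicit Types (D Om : set 'rV[R]_d).

Definition enorm (x : 'rV[R]_d) : R := Num.sqrt (\sum_i x ord0 i ^+ 2).

Section L2.
Context {n q : nat}.
Implicit Types (v w : mfield R d n q).

(* Elements of L^2(D) are represented by functions whose values outside D are
   irrelevant; equality in L^2(D) is [aeq D]. *)
Definition L2 D : set (mfield R d n q) := [set v : mfield R d n q | forall i j,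
  measurable_fun D (fun x => v x i j) /\
  (leb d).-integrable D (fun x => (v x i j ^+ 2)%:E)].

Definition aeq D v w : Prop := {ae leb d, forall x, D x -> v x = w x}.

Definition ip D v w : R :=
  \int[leb d]_(x in D) \sum_i \sum_j v x i j * w x i j.

Definition nrm D v : R := Num.sqrt (ip D v v).

Definition restr D v : mfield R d n q := fun x => if `[< D x >] then v x else 0.

End L2.

(* Column k of row i, extended by 0 for k >= q. *)
Definition ent (n q : nat) (M : 'M[R]_(n, q)) (i : 'I_n) (k : nat) : R :=
  oapp (M i) 0 (insub k).

Definition dirv (j : nat) : 'rV[R]_d := \row_i (i == j :> nat)%:R.

Definition pd (j : nat) (f : 'rV[R]_d -> R) (x : 'rV[R]_d) : R :=
  'D_(dirv j) f x.

Fixpoint Cfun (k : nat) (f : 'rV[R]_d -> R) : Prop :=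
  continuous f /\
  if k is k'.+1 then
    forall j : 'I_d, (forall x, derivable f x (dirv j)) /\ Cfun k' (pd j f)
  else True.

Definition smooth (f : 'rV[R]_d -> R) : Prop := forall k, Cfun k f.

Definition testfun Om (phi : 'rV[R]_d -> R) : Prop :=
  smooth phi /\
  exists K : set 'rV[R]_d, [/\ compact K, K `<=` Om & forall x, ~ K x -> phi x = 0].

(* A first-order differential operator with constant coefficients, acting on
   each row, is given by its formula [e]: [e dv i] is the i-th component of the
   result when [dv j k] stands for the j-th partial derivative of the k-th
   component of the row (indices start at 0). *)
Definition dop := (nat -> nat -> R) -> nat -> R.

Definition div_e : dop := fun dv _ => \sum_(j < d) dv j j.

Definition part_e (j : nat) : dop := fun dv k => dv j k.

Definition curl3_e : dop := fun dv i =>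
  dv ((i + 1) %% 3)%N ((i + 2) %% 3)%N - dv ((i + 2) %% 3)%N ((i + 1) %% 3)%N.

(* For d = 2: curl v = (d_2 v, - d_1 v) of scalar v and
   rot b = d_2 b_1 - d_1 b_2. *)
Definition curl_e : dop :=
  if d == 2%N then fun dv i => if i == 0%N then dv 1%N 0%N else - dv 0%N 0%N
  else curl3_e.

Definition rot_e : dop :=
  if d == 2%N then fun dv _ => dv 1%N 0%N - dv 0%N 1%N else curl3_e.

(* Number of components of the potentials to which curl applies. *)
Definition cdim : nat := if d == 2%N then 1%N else d.

Section operators.
Context {n p : nat} (e : dop) (q : nat).

Definition classical_op (v : mfield R d n p) : mfield R d n q :=
  fun x => \matrix_(r, i) e (fun j k => pd j (fun y => ent (v y) r k) x) i.

Definition is_weak Om (v : mfield R d n p) (g : mfield R d n q) : Prop :=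
  L2 Om g /\
  forall phi, testfun Om phi -> forall (r : 'I_n) (i : 'I_q),
    \int[leb d]_(x in Om) (g x r i * phi x) =
    - \int[leb d]_(x in Om) e (fun j k => ent (v x) r k * pd j phi x) i.

Definition weak_op Om (v : mfield R d n p) : mfield R d n q :=
  xget (fun=> 0) [set g : mfield R d n q | is_weak Om v g].

Definition weak_dom Om : set (mfield R d n p) :=
  [set v : mfield R d n p | L2 Om v /\ exists g, is_weak Om v g].

End operators.

Definition wdiv (n : nat) Om (t : mfield R d n d) : mfield R d n 1%N :=
  weak_op div_e 1%N Om t.
Definition Hdiv (n : nat) Om : set (mfield R d n d) := weak_dom div_e 1%N Om.

Definition wcurl (n : nat) Om (b : mfield R d n cdim) : mfield R d n d :=
  weak_op curl_e d Om b.
Definition Hcurl (n : nat) Om : set (mfield R d n cdim) := weak_dom curl_e d Om.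

Section H1.
Context {n q : nat}.
Implicit Types (v : mfield R d n q).

Definition wpart Om (j : 'I_d) v : mfield R d n q := weak_op (part_e j) q Om v.

Definition H1 Om : set (mfield R d n q) :=
  [set v : mfield R d n q | forall j : 'I_d, weak_dom (part_e j) q Om v].

Definition H1norm Om v : R :=
  Num.sqrt (nrm Om v ^+ 2 + \sum_(j < d) nrm Om (wpart Om j v) ^+ 2).

Definition H10 Om : set (mfield R d n q) := [set v : mfield R d n q | H1 Om v /\
  exists phi : nat -> mfield R d n q,
    (forall m i j, testfun Om (fun x => phi m x i j)) /\
    H1norm Om (phi m - v) @[m --> \oo] --> (0 : R)].

(* The set under [sup] is nonempty and bounded for psi in L^2(Om). *)
Definition Hm1norm Om (psi : mfield R d n q) : R :=
  sup [set ip Om psi v / H1norm Om v | v in [set v : mfield R d n q | H10 Om v /\ H1norm Om v != 0]].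

End H1.

End fields.

Arguments cdim d : clear implicits.
Arguments div_e {R} d _ _.
Arguments curl_e {R} d _ _.
Arguments rot_e {R} d _ _.
Arguments Hdiv {R d} n Om.
Arguments Hcurl {R d} n Om.

(* A simplex is given by its finite set of vertices, a triangulation by its
   finite set of elements. *)
Notation simplex R d := {fset 'rV[R]_d}.
Notation mesh R d := {fset {fset 'rV[R]_d}}.

Section meshes.
Context {R : realType} {d : nat}.
Implicit Types (K E : simplex R d) (T : mesh R d) (Om : set 'rV[R]_d).

Definition hull K : set 'rV[R]_d := [set x | exists l : 'rV[R]_d -> R,
  [/\ forall a, a \in K -> 0 <= l a, \sum_(a <- K) l a = 1
    & x = \sum_(a <- K) l a *: a]].

Definition affine_free K : Prop := forall l : 'rV[R]_d -> R,
  \sum_(a <- K) l a = 0 -> \sum_(a <- K) l a *: a = 0 ->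
  forall a, a \in K -> l a = 0.

Definition full_simplex K : Prop := #|` K| = d.+1 /\ affine_free K.

Definition triangulation Om T : Prop :=
  [/\ forall K, K \in T -> full_simplex K,
      closure Om = \bigcup_(K in [set` T]) hull K,
      forall K, K \in T -> interior (hull K) `<=` Om
    & forall K K', K \in T -> K' \in T ->
        hull K `&` hull K' = hull (K `&` K')%fset].

Definition refines (Th TH : mesh R d) : Prop :=
  forall K', K' \in Th -> exists2 K, K \in TH & hull K' `<=` hull K.

(* Edges (d = 2) or faces (d = 3). *)
Definition faces T : mesh R d := [fset (K `\ a)%fset | K in T, a in K]%fset.

Definition hK K : R := fine (leb d (hull K)) `^ (d%:R^-1).

(* diam K <= kappa * h_K *)
Definition shape_regular (kappa : R) T : Prop := forall K, K \in T ->
  forall x y, hull K x -> hull K y -> enorm (x - y) <= kappa * hK K.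

(* Surface integral over a face with vertices a_0, ..., a_{d-1}, through the
   affine parametrization by the reference simplex of R^{d-1}. *)
Definition ref_simplex (k : nat) : set 'rV[R]_k :=
  [set t | (forall i, 0 <= t ord0 i) /\ \sum_i t ord0 i <= 1].

Arguments ref_simplex k : clear implicits.

Definition face_mx E : 'M[R]_(d.-1, d) :=
  \matrix_(i < d.-1) (nth 0 E i.+1 - nth 0 E 0%N).

Definition face_param E (t : 'rV[R]_d.-1) : 'rV[R]_d :=
  nth 0 E 0%N + t *m face_mx E.

Definition fint E (g : 'rV[R]_d -> R) : R :=
  Num.sqrt (\det (face_mx E *m (face_mx E)^T)) *
  \int[leb d.-1]_(t in ref_simplex d.-1) g (face_param E t).

Definition hE E : R := fint E (fun=> 1) `^ ((d.-1)%:R^-1).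

Definition fnrm2 (n q : nat) E (v : mfield R d n q) : R :=
  fint E (fun x => \sum_i \sum_j v x i j ^+ 2).

Definition L2face (n q : nat) E (v : mfield R d n q) : Prop := forall i j,
  measurable_fun (ref_simplex d.-1) (fun t => v (face_param E t) i j) /\
  (leb d.-1).-integrable (ref_simplex d.-1)
    (fun t => (v (face_param E t) i j ^+ 2)%:E).

(* [g] is the trace on the face E of K of the H^1(Om)-field [v]. *)
Definition is_trace (n q : nat) Om K E (v g : mfield R d n q) : Prop :=
  L2face E g /\
  exists phi : nat -> mfield R d n q,
    [/\ forall m i j, smooth (fun x => phi m x i j),
        nrm (hull K) (phi m - v) @[m --> \oo] --> (0 : R),
        forall j : 'I_d, nrm (hull K)
          (classical_op (part_e j) q (phi m) - wpart Om j v) @[m --> \oo] --> (0 : R)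
      & fnrm2 E (phi m - g) @[m --> \oo] --> (0 : R)].

(* Unit normal, and for d = 2 unit tangent; each is determined up to sign. *)
Definition normal E : 'rV[R]_d := xget 0 [set nu | enorm nu = 1 /\
  forall a b, a \in E -> b \in E -> \sum_i nu ord0 i * (b - a) ord0 i = 0].

Definition tangent E : 'rV[R]_d := xget 0 [set t | enorm t = 1 /\
  forall a b, a \in E -> b \in E -> exists c, b - a = c *: t].

(* v . t_E for d = 2, v x nu_E for d = 3. *)
Definition tang (n : nat) E (v : mfield R d n d) : mfield R d n (cdim d) :=
  fun x => \matrix_(r, i)
    if d == 2%N then \sum_k v x r k * tangent E ord0 k
    else
      let c := ent (v x) r in let nu := ent (normal E) ord0 in
      c ((i + 1) %% 3)%N * nu ((i + 2) %% 3)%N -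
      c ((i + 2) %% 3)%N * nu ((i + 1) %% 3)%N.

Section discrete.
Context {n q : nat}.
Implicit Types (v w : mfield R d n q).

Definition is_polynomial v : Prop := forall i j,
  exists p : mpoly.mpoly d R, forall x,
    v x i j = mpoly.meval (fun k => x ord0 k) p.

Definition pw_polynomial T v : Prop := forall K, K \in T ->
  exists p, is_polynomial p /\ aeq (hull K) v p.

(* The polynomial that represents v on K. *)
Definition elt v K : mfield R d n q :=
  xget (fun=> 0) [set p : mfield R d n q | is_polynomial p /\ aeq (hull K) v p].

Definition fe_space Om T (V : set (mfield R d n q)) : Prop :=
  exists (m : nat) (b : 'I_m -> mfield R d n q),
    (forall l, L2 Om (b l) /\ pw_polynomial T (b l)) /\
    V = [set v : mfield R d n q | L2 Om v /\
           exists c : 'I_m -> R, aeq Om v (\sum_l c l *: b l)].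

(* Jump across E of the elementwise field w; its sign depends on the order in
   which the two elements are listed, and only its norm is used. *)
Definition jump T (w : simplex R d -> mfield R d n q) E : mfield R d n q :=
  fun x => match [seq K <- T | (E `<=` K)%fset] with
           | [::] => 0
           | [:: K] => w K x
           | K1 :: K2 :: _ => w K1 x - w K2 x
           end.

Definition norm1h T (G : set 'rV[R]_d) v : R :=
  Num.sqrt (\sum_(K <- T | `[< hull K `<=` G >])
              \sum_(j < d) nrm (hull K) (classical_op (part_e j) q (elt v K)) ^+ 2
          + \sum_(E <- faces T | `[< hull E `<=` G >])
              (hE E)^-1 * fnrm2 E (jump T (elt v) E)).

Definition elt_patch T K : set 'rV[R]_d :=
  \bigcup_(K' in [set K' | K' \in T /\ hull K' `&` hull K !=set0]) hull K'.

Definition l2proj Om (V : set (mfield R d n q)) (f : mfield R d n q) : mfield R d n q :=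
  xget (fun=> 0) [set g : mfield R d n q | V g /\ forall v, V v -> ip Om (f - g) v = 0].

Definition osc Om (V : set (mfield R d n q)) (f : mfield R d n q) (M : mesh R d) : R :=
  Num.sqrt (\sum_(K <- M) (hK K * nrm (hull K) (f - l2proj Om V f)) ^+ 2).

End discrete.

(* eta^2, as a function of t = A sigma_h. *)
Definition eta2 (n : nat) T (M : mesh R d) (t : mfield R d n d) : R :=
  \sum_(K <- M)
    ((hK K * nrm (hull K) (classical_op (rot_e d) (cdim d) (elt t K))) ^+ 2
     + \sum_(E <- faces T | `[< hull E `<=` hull K >])
         hE E * fnrm2 E (jump T (fun K' => tang E (elt t K')) E)).

End meshes.

Definition simply_connected {R : realType} {d : nat} (Om : set 'rV[R]_d) : Prop :=
  forall g : R -> 'rV[R]_d,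
    {within `[0, 1], continuous g} -> g @` `[0, 1] `<=` Om -> g 0 = g 1 ->
    exists H : R * R -> 'rV[R]_d,
      [/\ {within `[0, 1] `*` `[0, 1], continuous H},
          H @` (`[0, 1] `*` `[0, 1]) `<=` Om,
          forall t, `[0, 1]%classic t -> H (0, t) = g t,
          forall t, `[0, 1]%classic t -> H (1, t) = g 0
        & forall s, `[0, 1]%classic s -> H (s, 0) = g 0 /\ H (s, 1) = g 0].

Definition admissible_domain {R : realType} {d : nat} (Om : set 'rV[R]_d) : Prop :=
  [/\ Om !=set0, open Om, connected Om & bounded_set Om] /\
  simply_connected Om /\ exists T, triangulation Om T.

(* The admissible meshes; a constant is independent of the mesh when it is
   uniform over this class. *)
Record discretization (R : realType) (d n : nat) := Discretization {
  meshes : set (mesh R d);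
  Sigma_h : mesh R d -> set (mfield R d n d);
  U_h : mesh R d -> set (mfield R d n 1);
  Hcurl_h : mesh R d -> set (mfield R d n (cdim d))
}.

Section setting.
Context {R : realType} {d n : nat} (Om : set 'rV[R]_d).
Context (A : mfield R d n d -> mfield R d n d).
Context (Sigma : set (mfield R d n d)) (X : discretization R d n).
Implicit Types (f u v : mfield R d n 1) (s t : mfield R d n d) (T TH Th : mesh R d).

Definition nrmA t : R := Num.sqrt (ip Om (A t) t).

(* H(div), or for n = d its subspace of fields with mean-zero trace. *)
Definition stress_space : Prop :=
  Sigma = Hdiv n Om \/
  n = d /\ Sigma = [set t | Hdiv n Om t /\
    \int[leb d]_(x in Om) (\sum_(i < n) \sum_(j < d | i == j :> nat) t x i j) = 0].

Definition bounded_sym_psd : Prop :=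
  [/\ forall t, L2 Om t -> L2 Om (A t),
      forall a s t, L2 Om s -> L2 Om t ->
        aeq Om (A (a *: s + t)) (a *: A s + A t),
      exists2 C, 0 < C & forall t, L2 Om t -> nrm Om (A t) <= C * nrm Om t,
      forall s t, L2 Om s -> L2 Om t -> ip Om (A s) t = ip Om s (A t)
    & forall t, L2 Om t -> 0 <= ip Om (A t) t].

Definition coercive : Prop := exists2 C, 0 < C & forall t, Sigma t ->
  0 <= ip Om (A t) t <= C * nrm Om t ^+ 2 /\
  nrm Om t ^+ 2 <= C * (ip Om (A t) t + Hm1norm Om (wdiv Om t) ^+ 2).

Definition mixed_solution (S : set (mfield R d n d)) (U : set (mfield R d n 1))
    f s u : Prop :=
  [/\ S s, U u,
      forall t, S t -> ip Om (A s) t - ip Om (wdiv Om t) u = 0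
    & forall v, U v -> ip Om (wdiv Om s) v = ip Om f v].

Definition exact_solution f s u := mixed_solution Sigma (L2 Om) f s u.

Definition discrete_solution T f s u :=
  mixed_solution (Sigma_h X T) (U_h X T) f s u.

Definition nested TH Th : Prop :=
  [/\ meshes X TH, meshes X Th & refines Th TH].

Definition admissible_meshes : Prop :=
  (forall T, meshes X T -> triangulation Om T) /\
  exists kappa, forall T, meshes X T -> shape_regular kappa T.

Definition admissible_spaces : Prop :=
  [/\ forall T, meshes X T ->
        [/\ fe_space Om T (Sigma_h X T), Sigma_h X T `<=` Sigma,
            fe_space Om T (U_h X T), fe_space Om T (Hcurl_h X T)
          & Hcurl_h X T `<=` Hcurl n Om],
      forall T, meshes X T -> forall K, K \in T -> forall v, U_h X T v ->
        U_h X T (restr (hull K) v),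
      forall TH Th, nested TH Th -> U_h X TH `<=` U_h X Th
    & forall T, meshes X T -> forall t, Sigma_h X T t -> pw_polynomial T (A t)].

Definition inclusion : Prop :=
  (forall TH Th, nested TH Th -> Sigma_h X TH `<=` Sigma_h X Th) /\
  (forall T, meshes X T -> forall t, Sigma_h X T t -> U_h X T (wdiv Om t)).

(* Here the norm on the left is over all of the closed domain, boundary faces
   included. The set under [sup] is bounded because Sigma_h is finite-dimensional, and
   [sup set0 = 0]. *)
Definition discrete_inf_sup : Prop := exists2 C, 0 < C &
  forall T, meshes X T -> forall v, U_h X T v ->
    norm1h T (closure Om) v <=
    C * sup [set ip Om (wdiv Om t) v / nrm Om t
              | t in [set t | Sigma_h X T t /\ nrm Om t != 0]].

Definition local_approximation : Prop := exists2 C, 0 < C &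
  forall TH Th, nested TH Th ->
    exists S : mfield R d n 1 -> mfield R d n 1, forall v, U_h X Th v ->
      [/\ U_h X TH (S v),
          forall K, K \in TH -> K \in Th -> aeq (hull K) (S v) v
        & forall K, K \in TH -> K \notin Th ->
            nrm (hull K) (v - S v) <= C * hK K * norm1h Th (elt_patch Th K) v].

Definition touches_refined TH Th (K : simplex R d) : Prop :=
  exists K', [/\ K' \in TH, K' \notin Th & hull K `&` hull K' !=set0].

Definition curl_decomposition : Prop := exists2 C, 0 < C &
  forall TH Th, nested TH Th ->
  forall f sH uH, L2 Om f -> discrete_solution TH f sH uH ->
  forall xi, Sigma_h X Th xi -> aeq Om (wdiv Om xi) 0 ->
  exists (phi_h : mfield R d n (cdim d))
         (Pi : mfield R d n (cdim d) -> mfield R d n (cdim d)),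
    [/\ Hcurl_h X Th phi_h,
        forall w, Hcurl_h X Th w -> Hcurl_h X TH (Pi w),
        aeq Om xi (wcurl Om phi_h)
      & Sigma_h X TH (wcurl Om (Pi phi_h))] /\
    exists (psi : mfield R d n (cdim d)) (phi : mfield R d n d)
           (trpsi : simplex R d -> mfield R d n (cdim d)),
      [/\ H1 Om psi, L2 Om phi,
          aeq Om (wcurl Om (phi_h - Pi phi_h)) (wcurl Om psi + phi)
        & ip Om (A sH) phi = 0] /\
      [/\ forall K, K \in TH -> ~ touches_refined TH Th K -> aeq (hull K) psi 0,
          Num.sqrt (\sum_(K <- TH) ((hK K)^-1 * nrm (hull K) psi) ^+ 2)
            <= C * nrm Om (wcurl Om phi_h),
          forall K E, K \in TH -> E \in faces TH -> (E `<=` K)%fset ->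
            is_trace Om K E psi (trpsi E)
        & Num.sqrt (\sum_(E <- faces TH) (hE E)^-1 * fnrm2 E (trpsi E))
            <= C * nrm Om (wcurl Om phi_h)].

Definition a_posteriori : Prop :=
  exists Crel Ceff, [/\ 0 < Crel, 0 < Ceff &
    forall T, meshes X T -> forall f s u sh uh, L2 Om f ->
      exact_solution f s u -> discrete_solution T f sh uh ->
      nrmA (s - sh) ^+ 2
        <= Crel * (eta2 T T (A sh) + osc Om (U_h X T) f T ^+ 2) /\
      Ceff * eta2 T T (A sh) <= nrmA (s - sh) ^+ 2].

End setting.

(* Main.v *)
Require Import Defs.
From mathcomp Require Import all_boot all_order all_algebra finmap.
From mathcomp Require Import all_classical all_reals all_analysis.
From mathcomp Require Import measurable_realfun ring lra.
Import Order.TTheory GRing.Theory Num.Theory.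
Import numFieldNormedType.Exports.
Import HBNNSimple.
Local Open Scope classical_set_scope.
Local Open Scope ring_scope.

Set Implicit Arguments.
Unset Strict Implicit.
Unset Printing Implicit Defensive.

(** Let e = s - sh be the stress error. Subtracting the discrete equation from
    the exact one gives (A e, t) = (div t, u - uh) for every discrete t on the
    fine mesh, so (A e, sh - sH) = (div sh - div sH, v) with v = Pu - uh and Pu
    the L2-projection of u on the fine displacement space (Pu may replace u
    because divergences of discrete stresses lie in that space). The
    difference div sh - div sH annihilates the coarse displacements: both
    terms pair with them like f. Hence v may be replaced by v - S v, with S the
    local approximation operator, and there div sh acts like f and div sH like
    the coarse projection fH of f. This is [pairing_oscillation]:
    (A e, sh - sH) = (f - fH, v - S v).

    The function v - S v vanishes on the unrefined elements. On a refined
    element K its norm is at most a multiple of hK times the discrete norm of v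
    on the patch of K, so Cauchy-Schwarz yields osc(f, TH \ Th) times the
    square root of the sum of the squared patch norms ([local_pairing]). The
    patches overlap boundedly ([patch_overlap], [norm1h_patch_sum]), so this
    square root is at most a multiple of the global discrete norm of v, which
    the inf-sup condition bounds by a multiple of the energy norm of e, once
    more through the error equation ([inf_sup_error]). The second inequality
    is the first one combined with Young's inequality.

    The bounded overlap is the geometric part. By conformity two touching
    simplices share a vertex, so it suffices to bound the number of simplices
    at a vertex z ([vertex_degree]). Shrink each of them towards z until it has
    volume r^d, with the same small r for all: the shrunken simplices are
    disjoint, and shape regularity keeps them inside a cube of volume
    (2 kappa r)^d. For this, Lebesgue measure on R^d, built as an iterated
    product, has to scale under homotheties and to vanish on hyperplanes. *)

(** * Positive semidefinite forms on a subspace *)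

Section psd_forms.
Context {R : realType} {V : lmodType R}.
Implicit Types (L W : set V) (B : V -> V -> R) (u v w : V).

Definition linear_subspace W : Prop :=
  W 0 /\ forall a u v, W u -> W v -> W (a *: u + v).

Lemma subspaceD W u v : linear_subspace W -> W u -> W v -> W (u + v).
Proof. by move=> sW Wu Wv; rewrite -[u]scale1r; exact: sW.2. Qed.

Lemma subspaceZ W a u : linear_subspace W -> W u -> W (a *: u).
Proof. by move=> sW Wu; rewrite -[_ *: _]addr0; apply: sW.2 => //; exact: sW.1. Qed.

Lemma subspaceB W u v : linear_subspace W -> W u -> W v -> W (u - v).
Proof. by move=> sW Wu Wv; rewrite addrC -scaleN1r; exact: sW.2. Qed.

(** The form is only required to behave on L: integrals of products are
    additive for square-integrable fields only, while the ambient type contains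
    all fields. *)
Definition psd_form L B : Prop :=
  [/\ forall a u v w, L u -> L v -> L w -> B (a *: u + v) w = a * B u w + B v w,
      forall u v, L u -> L v -> B u v = B v u
    & forall u, L u -> 0 <= B u u].

Context {L : set V} {B : V -> V -> R} (sL : linear_subspace L) (fB : psd_form L B).

Lemma psdZl a u w : L u -> L w -> B (a *: u) w = a * B u w.
Proof.
case: fB => lB _ _ Lu Lw; have L0 := sL.1.
have := lB 1 0 0 w L0 L0 Lw; rewrite scale1r addr0 mul1r => /eqP.
rewrite -subr_eq0 opprD addrA subrr sub0r oppr_eq0 => /eqP B0.
by rewrite -[a *: u]addr0 lB// B0 addr0.
Qed.

Lemma psdDl u v w : L u -> L v -> L w -> B (u + v) w = B u w + B v w.
Proof. by case: fB => lB _ _ *; rewrite -[u in LHS]scale1r lB// mul1r. Qed.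

Lemma psdBl u v w : L u -> L v -> L w -> B (u - v) w = B u w - B v w.
Proof.
by case: fB => lB _ _ *; rewrite addrC -scaleN1r lB// mulN1r addrC.
Qed.

Lemma psdC u v : L u -> L v -> B u v = B v u.
Proof. by case: fB => _ + _; apply. Qed.

Lemma psdBr u v w : L u -> L v -> L w -> B w (u - v) = B w u - B w v.
Proof.
move=> Lu Lv Lw; rewrite psdC ?psdBl//; last exact: subspaceB.
by rewrite (psdC Lu) ?(psdC Lv).
Qed.

Lemma psd_sqB u v : L u -> L v -> B (u - v) (u - v) = B u u - 2 * B u v + B v v.
Proof.
move=> Lu Lv; have Luv := subspaceB sL Lu Lv.
by rewrite psdBl// !psdBr// (psdC Lv Lu); ring.
Qed.

(** The discriminant argument: u - t v has a nonnegative square for all t. If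
    B v v = 0, this quadratic is affine in t, which forces B u v = 0. *)
Lemma psd_cauchy_schwarz u v : L u -> L v ->
  `|B u v| <= Num.sqrt (B u u) * Num.sqrt (B v v).
Proof.
move=> Lu Lv; have [_ _ pB] := fB.
have uu := pB _ Lu; have vv := pB _ Lv.
rewrite -sqrtrM// -sqrtr_sqr ler_wsqrtr//.
have q t : 0 <= B u u - 2 * t * B u v + t ^+ 2 * B v v.
  have := pB _ (subspaceB sL Lu (subspaceZ t sL Lv)).
  have Ltv := subspaceZ t sL Lv.
  rewrite psd_sqB// psdZl// (psdC Lu Ltv) psdZl// (psdC Lv Ltv) psdZl// (psdC Lv Lu).
  by move=> h; apply: le_trans h _; rewrite le_eqVlt; apply/orP; left; apply/eqP; ring.
case: (eqVneq (B v v) 0) => [v0|vn0].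
  rewrite v0 mulr0; case: (eqVneq (B u v) 0) => [->|b0]; first by rewrite expr0n.
  (* at this t the affine function of t takes the value -1 *)
  have := q ((B u u + 1) / (2 * B u v)).
  rewrite v0 mulr0 addr0 (_ : 2 * _ * B u v = B u u + 1); first lra.
  by field.
have := q (B u v / B v v).
have vp : 0 < B v v by rewrite lt_neqAle eq_sym vn0.
rewrite (_ : _ - _ + _ = (B u u * B v v - B u v ^+ 2) / B v v); last by field.
by rewrite pmulr_lge0 ?invr_gt0// subr_ge0.
Qed.

(** The span as the least subspace, so that membership in the annihilator of
    a vector transfers from the generators. *)
Definition in_span (s : seq V) w : Prop :=
  forall W, linear_subspace W -> (forall b, b \in s -> W b) -> W w.

Lemma psd_annihilator u : L u -> linear_subspace [set v | L v /\ B u v = 0].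
Proof.
move=> Lu; split => [|a v w [Lv v0] [Lw w0]] /=.
  split; first exact: sL.1.
  by have := psdZl 0 Lu Lu; rewrite scale0r mul0r psdC //; exact: sL.1.
have Lav := subspaceZ a sL Lv.
split; first exact: sL.2.
rewrite psdC ?psdDl ?psdZl//; last exact: sL.2.
by rewrite (psdC Lv) ?(psdC Lw)// v0 w0 mulr0 addr0.
Qed.

(** Gram-Schmidt without normalization: b is replaced by its residual r
    modulo the other generators. The formula for the new coefficient also
    covers B r r = 0: division by zero returns zero, and then u - w1 is
    orthogonal to r by Cauchy-Schwarz. *)
Lemma span_projection (s : seq V) u : (forall b, b \in s -> L b) -> L u ->
  exists2 w : V, in_span s w & forall b : V, b \in s -> B (u - w) b = 0.
Proof.
elim: s u => [|b s IH] u Ls Lu.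
  by exists 0 => // W sW _; exact: sW.1.
have Ls' c : c \in s -> L c by move=> cs; apply: Ls; rewrite inE cs orbT.
have Lb : L b by apply: Ls; rewrite inE eqxx.
have [w0 sw0 o0] := IH b Ls' Lb.
have [w1 sw1 o1] := IH u Ls' Lu.
have Lw0 : L w0 by exact: sw0.
have Lw1 : L w1 by exact: sw1.
pose r := b - w0; have Lr : L r by exact: subspaceB.
have Lu1 : L (u - w1) by exact: subspaceB.
pose al := B (u - w1) r / B r r.
have Lar := subspaceZ al sL Lr.
have E : u - (w1 + al *: r) = u - w1 - al *: r by rewrite opprD addrA.
have Lu2 : L (u - (w1 + al *: r)) by rewrite E; exact: subspaceB.
have os c : c \in s -> B (u - (w1 + al *: r)) c = 0.
  move=> cs; rewrite E psdBl//; last exact: Ls'.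
  by rewrite psdZl ?o0 ?o1 ?mulr0 ?subr0//; exact: Ls'.
have or : B (u - (w1 + al *: r)) r = 0.
  rewrite E psdBl// psdZl// /al; case: (eqVneq (B r r) 0) => [r0|rn0].
    have := psd_cauchy_schwarz Lu1 Lr; rewrite r0 sqrtr0 mulr0 normr_le0 => /eqP ->.
    by rewrite mulr0 subr0.
  by rewrite mulfVK// subrr.
exists (w1 + al *: r).
  move=> W sW sub; have sub' c : c \in s -> W c.
    by move=> cs; apply: sub; rewrite inE cs orbT.
  apply: subspaceD => //; first exact: sw1.
  apply: subspaceZ => //; apply: subspaceB => //; last exact: sw0.
  by apply: sub; rewrite inE eqxx.
move=> c; rewrite inE => /orP[/eqP ->|]; last exact: os.
have -> : b = r + w0 by rewrite /r addrNK.
have [_] : [set v | L v /\ B (u - (w1 + al *: r)) v = 0] (r + w0); last by [].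
apply: subspaceD; [exact: psd_annihilator|by []|].
apply: sw0; first exact: psd_annihilator.
by move=> c' cs; split; [exact: Ls'|exact: os].
Qed.

End psd_forms.

(** * Lebesgue measure on R^d: hyperplanes, homotheties, cubes *)

Section leb.
Context {R : realType}.

Lemma measurable_affine1 (t b : R) : measurable_fun setT (fun x : R => t * x + b).
Proof. by apply: measurable_funD => //; apply: measurable_funM. Qed.

(** Scaling the image measure by t gives a measure that agrees with Lebesgue
    measure on intervals; hence the two are equal. *)
Lemma lebesgue_preimage_affine (t b : R) (t0 : 0 < t)
    (A : set (measurableTypeR R)) : measurable A ->
  (lebesgue_measure ((fun x => t * x + b)%R @^-1` A) =
   (t^-1)%:E * @lebesgue_measure R A)%E.
Proof.
move=> mA.
have mf : measurable_fun (setT : set (measurableTypeR R))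
    (fun x : measurableTypeR R => (t * x + b : measurableTypeR R)).
  exact: measurable_affine1.
(* The image measure; its measure structure depends on the proof mf. *)
pose m1 : {measure set (measurableTypeR R) -> \bar R} :=
  measure_function_pushforward__canonical__measure_function_Measure
    (@lebesgue_measure R) mf.
pose m2 : {measure set (measurableTypeR R) -> \bar R} := mscale (NngNum (ltW t0)) m1.
have -> : lebesgue_measure A = m2 A.
  apply: lebesgue_measure_unique => //.
  move=> _ [[x y] _ <-] /=.
  rewrite /m2 /mscale /= /pushforward.
  rewrite (_ : _ @^-1` _ = `](x - b)/t, (y-b)/t]%classic); last first.
    apply/seteqP; split => z /=; rewrite !in_itv /= ltr_pdivrMr//;
      by rewrite ler_pdivlMr// ltrBlDr lerBrDr mulrC.
  rewrite !lebesgue_measure_itv/= !lte_fin ltr_pM2r ?invr_gt0// ltrBlDr subrK.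
  case: ifP => xy; last by rewrite mule0.
  by rewrite -!EFinB -EFinM -mulrBl opprB addrA subrK mulrC mulfVK// gt_eqF.
by rewrite /m2 /mscale/= muleA -EFinM mulVf ?gt_eqF// mul1e.
Qed.

Lemma measurable_affine_form d (c : R) (g : 'I_d -> R) :
  measurable_fun setT (fun x : 'rV[R]_d => c + \sum_j g j * x ord0 j).
Proof.
apply: measurable_funD => //; apply: measurable_sum => j.
by apply: measurable_funM => //; exact: measurable_coord.
Qed.

Lemma measurable_hyperplane d (c : R) (g : 'I_d -> R) :
  measurable [set x : 'rV[R]_d | c + \sum_j g j * x ord0 j = 0].
Proof.
rewrite -[X in measurable X]setTI.
exact: (measurable_affine_form c g measurableT (measurable_set1 0)).
Qed.

Lemma leb_cons d (A : set 'rV[R]_d.+1) :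
  leb d.+1 A = ((@lebesgue_measure R \x leb d) (@cons_rV R d @^-1` A))%E.
Proof. by []. Qed.

(** Fubini along the first coordinate: if some other coefficient is nonzero,
    every section is a hyperplane of one dimension less; otherwise the
    hyperplane is a point times R^d. *)
Lemma leb_hyperplane d (c : R) (g : 'I_d -> R) (i : 'I_d) : g i != 0 ->
  leb d [set x : 'rV[R]_d | c + \sum_j g j * x ord0 j = 0] = 0%E.
Proof.
elim: d c g i => [|d IH] c g i gi; first by case: i gi.
rewrite leb_cons.
have E p : (c + \sum_j g j * (cons_rV p) ord0 j = 0) =
    (c + g ord0 * p.1 + \sum_j g (lift ord0 j) * p.2 ord0 j = 0).
  rewrite big_ord_recl mxE unlift_none /= addrA.
  by congr (_ + _ = _); apply: eq_bigr => j _; rewrite mxE liftK.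
case: (pselect (exists j, g (lift ord0 j) != 0)) => [[j gj]|nj].
  rewrite /product_measure1; apply: integral0_eq => a _ /=.
  rewrite (_ : xsection _ _ = [set y : 'rV[R]_d |
    (c + g ord0 * a) + \sum_j g (lift ord0 j) * y ord0 j = 0]); first exact: (IH _ _ j).
  by apply/seteqP; split => y; rewrite /xsection /= inE /= E.
have g0 j : g (lift ord0 j) = 0.
  by apply/eqP; apply: contrapT => /negP h; apply: nj; exists j.
have gi0 : g ord0 != 0.
  by move: gi; case: (unliftP ord0 i) => [j|] -> //; rewrite g0 eqxx.
rewrite (_ : _ @^-1` _ = [set - c / g ord0] `*` setT); last first.
  apply/seteqP; split => -[a y] /=; rewrite E/= big1 ?addr0;
    try by move=> j _; rewrite g0 mul0r.
    move=> H; split => //; have -> : - c = g ord0 * a.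
      by apply/eqP; rewrite eq_sym -subr_eq0 opprK addrC H.
    by rewrite mulrC mulKf.
  by move=> [-> _]; rewrite mulrC mulfVK// subrr.
rewrite product_measure1E//.
by rewrite [X in (X * _)%E](_ : _ = 0%E) ?mul0e//; exact: lebesgue_measure_set1.
Qed.

Lemma measurable_affine_rV d (t : R) (b : 'rV[R]_d) :
  measurable_fun setT (fun x : 'rV[R]_d => t *: x + b).
Proof.
apply: measurable_fun_coordP => i.
rewrite (_ : (fun _ => _) = fun x : 'rV[R]_d => t * x ord0 i + b ord0 i).
  apply: measurable_funD => //; apply: measurable_funM => //.
  exact: measurable_coord.
by apply/funext => x; rewrite !mxE.
Qed.

(** By induction on d and uniqueness of product measures: the image measure
    scaled by t^(d+1) has the right values on rectangles. *)
Lemma leb_preimage_homothety d (t : R) (b : 'rV[R]_d) (t0 : 0 < t) (A : set 'rV[R]_d) :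
  measurable A ->
  (leb d ((fun x => t *: x + b)%R @^-1` A) = (t^-1 ^+ d)%:E * leb d A)%E.
Proof.
elim: d b A => [|d IH] b A mA.
  rewrite expr0 mul1e; congr (leb 0 _); apply/seteqP; split => x /=;
   by rewrite [_ + b](_ : _ = x)//; apply/rowP => -[].
pose b0 := b ord0 ord0; pose b' : 'rV[R]_d := \row_i b ord0 (lift ord0 i).
have mf : measurable_fun (setT : set (measurableTypeR R * 'rV[R]_d))
    (fun p : measurableTypeR R * 'rV[R]_d =>
      (t * p.1 + b0 : measurableTypeR R, t *: p.2 + b')).
  apply: measurable_fun_pair => /=.
    by apply: measurable_funD => //; apply: measurable_funM => //.
  apply: (@measurableT_comp _ _ _ _ _ _ (fun x : 'rV[R]_d => t *: x + b') _ snd).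
    exact: measurable_affine_rV.
  exact: measurable_snd.
pose F := fun p : R * 'rV[R]_d => (t * p.1 + b0, t *: p.2 + b').
pose m1 : {measure set (measurableTypeR R * 'rV[R]_d) -> \bar R} :=
  measure_function_pushforward__canonical__measure_function_Measure
    (@lebesgue_measure R \x leb d)%E mf.
have td : 0 <= t ^+ d.+1 by rewrite exprn_ge0// ltW.
pose m2 : {measure set (measurableTypeR R * 'rV[R]_d) -> \bar R} :=
  mscale (NngNum td) m1.
have m2E (B : set (R * 'rV[R]_d)) : m2 B =
  ((t ^+ d.+1)%:E * (@lebesgue_measure R \x leb d) (F @^-1` B))%E by [].
rewrite !leb_cons.
have mcA : measurable (@cons_rV R d @^-1` A).
  by rewrite -[X in measurable X]setTI; exact: measurable_cons_rV.
rewrite [in RHS](@product_measure_unique _ _ _ _ _ _ _ m2 _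
  (@cons_rV R d @^-1` A)) //; last first.
  move=> B C mB mC; rewrite m2E.
  rewrite (_ : _ @^-1` _ = ((fun x => t * x + b0) @^-1` B) `*`
    ((fun x => t *: x + b') @^-1` C)) //.
  rewrite product_measure1E; last 2 first.
  - by rewrite -[X in measurable X]setTI; exact: measurable_affine1.
  - by rewrite -[X in measurable X]setTI; exact: measurable_affine_rV.
  rewrite IH// [X in (_ * (X * _))%E](_ : _ =
    ((t^-1)%:E * @lebesgue_measure R B)%E); last first.
    exact: lebesgue_preimage_affine.
  rewrite [X in (_ * X)%E]muleACA -EFinM -exprS.
  by rewrite [LHS]muleA -EFinM -exprMn mulfV ?gt_eqF// expr1n mul1e.
rewrite m2E muleA -EFinM exprVn mulVf; last by rewrite expf_neq0// gt_eqF.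
rewrite mul1e; congr (product_measure1 _ _ _); apply/seteqP.
by split => -[x y] /=; congr (A _); apply/rowP => i; rewrite !mxE;
  case: (unliftP ord0 i) => [j|] ->; rewrite ?liftK ?unlift_none /= ?mxE.
Qed.

Lemma measurable_cube d (b : 'rV[R]_d) (r : R) :
  measurable [set x : 'rV[R]_d | forall i, `|x ord0 i - b ord0 i| <= r].
Proof.
rewrite (_ : [set _ | _] = \bigcap_i ((fun x : 'rV[R]_d => x ord0 i) @^-1`
    `[b ord0 i - r, b ord0 i + r]%classic)); last first.
  apply/seteqP; split => x /= H i; have := H i;
    by rewrite /= in_itv /= ler_distl => // /(_ I).
apply: fin_bigcap_measurable; first exact: finite_finset.
by move=> i _; rewrite -[X in measurable X]setTI; apply: measurable_coord.
Qed.

Lemma leb_cube d (b : 'rV[R]_d) (r : R) : 0 <= r ->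
  leb d [set x : 'rV[R]_d | forall i, `|x ord0 i - b ord0 i| <= r] = ((2 * r) ^+ d)%:E.
Proof.
move=> r0; elim: d b => [|d IH] b.
  rewrite (_ : [set _ | _] = setT); last by apply/seteqP; split => // x _ [].
  by rewrite expr0 /= diracT.
rewrite leb_cons.
pose b' : 'rV[R]_d := \row_i b ord0 (lift ord0 i).
rewrite (_ : _ @^-1` _ = `[b ord0 ord0 - r, b ord0 ord0 + r]%classic `*`
   [set x : 'rV[R]_d | forall i, `|x ord0 i - b' ord0 i| <= r]); last first.
  apply/seteqP; split => -[x y] /=.
    move=> H; split.
      by have := H ord0; rewrite mxE unlift_none /= in_itv/= ler_distl.
    by move=> i; have := H (lift ord0 i); rewrite !mxE liftK.
  move=> [H1 H2] i; rewrite mxE; case: (unliftP ord0 i) => [j|] ->.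
    by have := H2 j; rewrite !mxE.
  by rewrite ler_distl; move: H1; rewrite in_itv.
rewrite product_measure1E//; last exact: measurable_cube.
rewrite IH [X in (X * _)%E](_ : _ = (2 * r)%:E); first by rewrite -EFinM -exprS.
apply: (etrans (lebesgue_measure_itv _)); rewrite /= lte_fin.
have E : b ord0 ord0 + r - (b ord0 ord0 - r) = 2 * r.
  by rewrite opprB addrC addrA addrNK mulr_natl.
case: ifPn => [_|]; first by rewrite -EFinB E.
rewrite -leNgt -subr_le0 E => H.
have -> : r = 0 by apply/eqP; rewrite eq_le r0 andbT -(pmulr_rle0 _ (ltr0n R 2)).
by rewrite mulr0.
Qed.

(** An open set is the union of the cubes with rational centre and radius
    1/(k+1) that it contains. *)
Lemma open_measurable_rV d (U : set 'rV[R]_d) : open U -> measurable U.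
Proof.
move=> oU.
pose C (p : 'rV[rat]_d * nat) := [set x : 'rV[R]_d |
  forall i, `|x ord0 i - (map_mx ratr p.1) ord0 i| <= p.2.+1%:R^-1].
rewrite (_ : U = \bigcup_(p in [set p | C p `<=` U]) C p); last first.
  apply/seteqP; split => [x Ux|x [p /= pU]]; last exact: pU.
  have /nbhs_ballP [e /= e0 eU] : nbhs x U by exact: open_nbhs_nbhs.
  have [k ke] : exists k : nat, k.+1%:R^-1 < e / 2.
    have [k _ /(_ k (leqnn k))] :=
      near_infty_natSinv_lt (PosNum (divr_gt0 e0 (ltr0n R 2))).
    by exists k.
  have k0 : 0 < k.+1%:R^-1 :> R by rewrite invr_gt0.
  have h i : {q : rat | `|x ord0 i - ratr q| < k.+1%:R^-1}.
    apply: cid; have := @dense_rat R (ball (x ord0 i) (k.+1%:R^-1)) _ (ball_open _ _).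
    case; first by exists (x ord0 i); exact: ballxx.
    by move=> z [/= B [q _ E]]; exists q; move: B; rewrite -E.
  exists (\row_i sval (h i), k) => /=.
    move=> y Cy; apply: eU; split => // i j; rewrite ord1.
    have := Cy j; rewrite /= !mxE; case: (h j) => q /= hq hy.
    rewrite -ball_normE /= -(addrNK (ratr q) (x ord0 j)) -addrA.
    apply: (le_lt_trans (ler_normD _ _)); rewrite [e]splitr; apply: ltrD.
      exact: lt_trans ke.
    by rewrite distrC; apply: le_lt_trans ke.
  by move=> i; rewrite !mxE; case: (h i) => q /= /ltW.
rewrite bigcup_mkcond; apply: countable_bigcupT_measurable; first exact: countableP.
by move=> p; case: ifP => // _; exact: measurable_cube.
Qed.

End leb.

(** * Barycentric coordinates *)

Section simplices.
Context {R : realType} {d : nat}.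
Implicit Types (K F : simplex R d) (T : mesh R d) (x : 'rV[R]_d).

(** The coefficients (c, g) of one affine function x |-> c a + sum_j g a j x_j
    for each point a. *)
Definition affine_coords := (('rV[R]_d -> R) * ('rV[R]_d -> 'I_d -> R))%type.

Definition eval_coords (p : affine_coords) (a x : 'rV[R]_d) : R :=
  p.1 a + \sum_j p.2 a j * x ord0 j.

Definition is_barycentric K (p : affine_coords) : Prop := forall x,
  \sum_(a <- K) eval_coords p a x = 1 /\
  \sum_(a <- K) eval_coords p a x *: a = x.

(** The matrix M with rows (1, a), for a a vertex, is invertible by affine
    independence, and the coordinates of x are the row (1, x) M^-1. *)
Lemma barycentric_exists K : full_simplex K -> exists p, is_barycentric K p.
Proof.
move=> [cK fK].
have sK : size (K : seq _) = d.+1 := cK.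
pose s := (K : seq 'rV[R]_d).
pose M : 'M[R]_d.+1 := \matrix_(i, j) oapp (nth 0 s i ord0) 1 (unlift ord0 j).
have uM : M \in unitmx.
  rewrite -row_free_unit -kermx_eq0; apply/eqP/row_matrixP => i.
  rewrite row0; set v := row i _.
  have vM : v *m M = 0 by rewrite /v -row_mul mulmx_ker row0.
  clearbody v.
  pose l a := v ord0 (inord (index a s)).
  have lE (k : 'I_d.+1) : l (nth 0 s k) = v ord0 k.
    by rewrite /l index_uniq ?fset_uniq ?inord_val// sK.
  have S (V : lmodType R) (F : 'rV[R]_d -> V) :
      \sum_(a <- K) l a *: F a = \sum_(k < d.+1) v ord0 k *: F (nth 0 s k).
    by rewrite (big_nth 0) sK big_mkord; apply: eq_bigr => k _; rewrite lE.
  have l0 : forall a, a \in K -> l a = 0.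
    apply: fK.
      have := S R^o (fun=> 1); rewrite /GRing.scale/=.
      under eq_bigr do rewrite mulr1.
      move=> ->; have /matrixP/(_ ord0 ord0) := vM; rewrite !mxE => E.
      by rewrite -[RHS]E; apply: eq_bigr => k _; rewrite !mxE unlift_none.
    rewrite (S _ id); apply/rowP => j.
    have /matrixP/(_ ord0 (lift ord0 j)) := vM; rewrite !mxE => E.
    rewrite -[RHS]E summxE; apply: eq_bigr => k _.
    by rewrite !mxE liftK.
  apply/rowP => k; rewrite -lE mxE; apply: l0.
  by rewrite mem_nth// sK.
pose N := invmx M.
pose ix a : 'I_d.+1 := inord (index a s).
exists (fun a => N ord0 (ix a), fun a j => N (lift ord0 j) (ix a)) => x.
pose X : 'rV[R]_d.+1 := \row_j oapp (x ord0) 1 (unlift ord0 j).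
have ixE (k : 'I_d.+1) : ix (nth 0 s k) = k.
  by rewrite /ix index_uniq ?fset_uniq ?inord_val// sK.
have eE a : eval_coords (fun a => N ord0 (ix a), fun a j => N (lift ord0 j) (ix a)) a x
   = (X *m N) ord0 (ix a).
  rewrite /eval_coords /= mxE big_ord_recl mxE unlift_none /= mul1r; congr (_ + _).
  by apply: eq_bigr => j _; rewrite mxE liftK mulrC.
have XE : X *m N *m M = X by rewrite mulmxKV.
under eq_bigr do rewrite eE.
under [X in _ /\ X = _]eq_bigr do rewrite eE.
split.
  rewrite (big_nth 0) sK big_mkord.
  have /rowP/(_ ord0) := XE; rewrite [X in _ = X]mxE unlift_none /= => <-.
  by rewrite [RHS]mxE; apply: eq_bigr => k _; rewrite ixE [M _ _]mxE unlift_none mulr1.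
rewrite (big_nth 0) sK big_mkord; apply/rowP => j.
have /rowP/(_ (lift ord0 j)) := XE; rewrite [X in _ = X]mxE liftK /= => <-.
rewrite [RHS]mxE summxE; apply: eq_bigr => k _.
by rewrite [LHS]mxE ixE [M _ _]mxE liftK.
Qed.

(** Barycentric coordinates; meaningful when K is a full simplex. *)
Definition bcoord K : 'rV[R]_d -> 'rV[R]_d -> R :=
  eval_coords (xget (fun=> 0, fun=> fun=> 0) (is_barycentric K)).

Lemma bcoord_affine K a :
  exists c g, forall x, bcoord K a x = c + \sum_j g j * x ord0 j.
Proof. by rewrite /bcoord /eval_coords; eexists; eexists => x; reflexivity. Qed.

Lemma bcoord_barycentric K : full_simplex K -> forall x,
  \sum_(a <- K) bcoord K a x = 1 /\ \sum_(a <- K) bcoord K a x *: a = x.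
Proof.
move=> /barycentric_exists [p hp]; rewrite /bcoord.
by case: xgetP => [q _ hq|/(_ p)]; [exact: hq|].
Qed.

Lemma bcoord_uniq K (l : 'rV[R]_d -> R) x : full_simplex K ->
  \sum_(a <- K) l a = 1 -> \sum_(a <- K) l a *: a = x ->
  forall a, a \in K -> l a = bcoord K a x.
Proof.
move=> fK l1 lx a aK; have [s1 sx] := bcoord_barycentric fK x.
have := fK.2 (fun a => l a - bcoord K a x); rewrite sumrB l1 s1 subrr => /(_ erefl).
under eq_bigr do rewrite scalerBl.
by rewrite sumrB lx sx subrr => /(_ erefl a aK)/eqP; rewrite subr_eq0 => /eqP.
Qed.

Lemma hullE K : full_simplex K ->
  hull K = [set x | forall a, a \in K -> 0 <= bcoord K a x].
Proof.
move=> fK; apply/seteqP; split => x /=.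
  by move=> [l [l0 l1 lx]] a aK; rewrite -(bcoord_uniq fK l1 _ aK)// l0.
move=> H; exists (fun a => bcoord K a x).
by have [s1 sx] := bcoord_barycentric fK x; split.
Qed.

Lemma sum_extend (V : lmodType R) K F (l : 'rV[R]_d -> R) (G : 'rV[R]_d -> V) :
  (F `<=` K)%fset ->
  \sum_(a <- K) (if a \in F then l a else 0) *: G a = \sum_(a <- F) l a *: G a.
Proof.
move=> FK; rewrite -(big_fset_incl _ FK) /=; last first.
  by move=> a aK /negbTE ->; rewrite scale0r.
by apply: eq_big_seq => a aF; rewrite aF.
Qed.

Lemma bcoord_comb K F (l : 'rV[R]_d -> R) x : full_simplex K -> (F `<=` K)%fset ->
  \sum_(a <- F) l a = 1 -> \sum_(a <- F) l a *: a = x ->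
  forall a, a \in K -> bcoord K a x = if a \in F then l a else 0.
Proof.
move=> fK FK l1 lx a aK; apply/esym.
apply: (bcoord_uniq (l := fun a => if a \in F then l a else 0)) => //.
  have := sum_extend l (fun=> 1 : R^o) FK.
  under eq_bigr do rewrite /GRing.scale /= mulr1.
  move=> ->; rewrite -[RHS]l1; apply: eq_bigr => b _.
  by rewrite /GRing.scale /= mulr1.
by rewrite (sum_extend _ id FK).
Qed.

(** Coordinates with respect to a face F, extended by zero, are those with
    respect to K. *)
Lemma hull_face K F x : full_simplex K -> (F `<=` K)%fset -> hull F x ->
  hull K x /\ forall a, a \in K -> a \notin F -> bcoord K a x = 0.
Proof.
move=> fK FK [l [l0 l1 lx]]; have E := bcoord_comb fK FK l1 (esym lx); split.
  rewrite hullE//= => a aK; rewrite E//; case: ifP => // aF; exact: l0.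
by move=> a aK /negbTE aF; rewrite E// aF.
Qed.

Lemma hull_vertex K a : a \in K -> hull K a.
Proof.
move=> aK; exists (fun b => (b == a)%:R); split.
- by move=> b _; case: eqP.
- rewrite (big_fsetD1 a)//= eqxx big_seq big1 ?addr0// => b.
  by rewrite !inE => /andP[/negbTE ->].
- rewrite (big_fsetD1 a)//= eqxx scale1r big_seq big1 ?addr0// => b.
  by rewrite !inE => /andP[/negbTE ->]; rewrite scale0r.
Qed.

Lemma bcoord_vertex K a b : full_simplex K -> a \in K -> b \in K ->
  bcoord K a b = (a == b)%:R.
Proof.
move=> fK aK bK.
rewrite (bcoord_comb (F := [fset b]%fset) (l := fun=> 1) fK) ?big_seq_fset1 ?scale1r//.
  by rewrite inE; case: eqP.
by rewrite fsub1set.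
Qed.

Lemma full_simplex_other K a : (0 < d)%N -> full_simplex K -> a \in K ->
  exists2 b, b \in K & b != a.
Proof.
move=> d0 [cK _] aK.
have : (0 < #|` (K `\ a)%fset|)%N.
  by move: cK; rewrite (cardfsD1 a) aK add1n => -[->].
by rewrite cardfs_gt0 => /fset0Pn[b]; rewrite !inE => /andP[ba bK]; exists b.
Qed.

(** A barycentric coordinate is not constant, as it separates two vertices, so
    its zero set is a hyperplane. *)
Lemma bcoord_zero_null K a : (0 < d)%N -> full_simplex K -> a \in K ->
  measurable [set x | bcoord K a x = 0] /\ leb d [set x | bcoord K a x = 0] = 0%E.
Proof.
move=> d0 fK aK; have [c [g E]] := bcoord_affine K a.
rewrite (_ : [set _ | _] =
  [set x : 'rV[R]_d | c + \sum_j g j * x ord0 j = 0]); last first.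
  by apply/seteqP; split => x /=; rewrite E.
split; first exact: measurable_hyperplane.
have [j gj] : exists j, g j != 0.
  apply: contrapT => H.
  have gz x : bcoord K a x = c.
    rewrite E big1 ?addr0// => j _; suff -> : g j = 0 by rewrite mul0r.
    by apply/eqP; apply: contrapT => /negP gj; apply: H; exists j.
  have [b bK ba] := full_simplex_other d0 fK aK.
  have := bcoord_vertex fK aK aK; have := bcoord_vertex fK aK bK.
  by rewrite !gz eqxx eq_sym (negbTE ba) => -> /eqP; rewrite eq_sym oner_eq0.
exact: leb_hyperplane gj.
Qed.

(** The interior of the simplex; described by coordinates, it is visibly
    measurable, open, and disjoint from the other elements of a mesh. *)
Definition open_hull K : set 'rV[R]_d :=
  [set x | forall a, a \in K -> 0 < bcoord K a x].

Lemma open_hull_hull K : full_simplex K -> open_hull K `<=` hull K.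
Proof. by move=> fK x H; rewrite hullE//= => a /H/ltW. Qed.

Lemma measurable_bcoord K a : measurable_fun setT (bcoord K a).
Proof.
have [c [g E]] := bcoord_affine K a.
by rewrite (_ : bcoord K a = fun x => c + \sum_j g j * x ord0 j);
  [exact: measurable_affine_form|apply/funext].
Qed.

Lemma continuous_affine_form (c : R) (g : 'I_d -> R) :
  continuous (fun x : 'rV[R]_d => c + \sum_j g j * x ord0 j).
Proof.
move=> x; apply: (@continuousD R R^o _ (fun=> c) _ x); first exact: cst_continuous.
rewrite (_ : (fun _ => _) = \sum_j (fun x : 'rV[R]_d => g j * x ord0 j)); last first.
  by apply/funext => y; rewrite fct_sumE.
elim/big_ind : _ => [|f1 f2 h1 h2|j _]; first exact: cst_continuous.
  exact: (@continuousD R R^o _ f1 f2 x).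
apply: (@continuousM R _ (fun=> g j) _ x); first exact: cst_continuous.
exact: coord_continuous.
Qed.

Lemma continuous_bcoord K a : continuous (bcoord K a).
Proof.
have [c [g E]] := bcoord_affine K a.
rewrite (_ : bcoord K a = fun x => c + \sum_j g j * x ord0 j); last exact/funext.
exact: continuous_affine_form.
Qed.

Lemma bigcap_fset_memE K (P : 'rV[R]_d -> set 'rV[R]_d) :
  [set x | forall a, a \in K -> P a x] = \bigcap_(a in [set` K]) P a.
Proof. by []. Qed.

Lemma measurable_open_hull K : measurable (open_hull K).
Proof.
rewrite /open_hull (bigcap_fset_memE K (fun a => [set x | 0 < bcoord K a x])).
apply: fin_bigcap_measurable; first exact: finite_fset.
move=> a _; rewrite (_ : [set _ | _] = bcoord K a @^-1` `]0, +oo[%classic).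
  by rewrite -[X in measurable X]setTI; apply: measurable_bcoord.
by apply/seteqP; split => x; rewrite /= in_itv /= andbT.
Qed.

Lemma measurable_hull K : full_simplex K -> measurable (hull K).
Proof.
move=> fK; rewrite hullE// (bigcap_fset_memE K (fun a => [set x | 0 <= bcoord K a x])).
apply: fin_bigcap_measurable; first exact: finite_fset.
move=> a _; rewrite (_ : [set _ | _] = bcoord K a @^-1` `[0, +oo[%classic).
  by rewrite -[X in measurable X]setTI; apply: measurable_bcoord.
by apply/seteqP; split => x; rewrite /= in_itv /= andbT.
Qed.

Lemma open_open_hull K : open (open_hull K).
Proof.
rewrite /open_hull (bigcap_fset_memE K (fun a => [set x | 0 < bcoord K a x])).
rewrite -bigsetI_fset_set; last exact: finite_fset.
elim/big_ind : _ => [|A B oA oB|a _]; [exact: openT|exact: openI|].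
apply: (@open_comp _ _ (bcoord K a) [set y | 0 < y]) => [x _|].
  exact: continuous_bcoord.
exact: open_gt.
Qed.

Lemma leb_hullD K : (0 < d)%N -> full_simplex K ->
  leb d (hull K `\` open_hull K) = 0%E.
Proof.
move=> d0 fK.
apply: measure_negligible.
  by apply: measurableD; [exact: measurable_hull|exact: measurable_open_hull].
apply: (@negligibleS _ _ _ _
    (\big[setU/set0]_(a <- K | a \in K) [set x | bcoord K a x = 0])).
  move=> x []; rewrite hullE//= => H nH.
  have [a aK a0] : exists2 a, a \in K & bcoord K a x = 0.
    apply: contrapT => N; apply: nH => a aK; rewrite lt_neqAle H// andbT.
    by apply/eqP => /esym a0; apply: N; exists a.
  by rewrite -bigcup_seq_cond; exists a => //=; rewrite aK.
elim/big_ind : _ => [|A B|a aK]; [exact: negligible_set0|exact: negligibleU|].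
by have [m0 z0] := bcoord_zero_null d0 fK aK; exact/negligibleP.
Qed.

End simplices.

(** * Bounded overlap of patches in shape-regular triangulations *)

Section triangulations.
Context {R : realType} {d : nat}.
Context (d0 : (0 < d)%N).
Implicit Types (K F : simplex R d) (T : mesh R d) (x : 'rV[R]_d).

Lemma ler_coord_enorm x i : `|x ord0 i| <= enorm x.
Proof.
rewrite /enorm -sqrtr_sqr ler_wsqrtr// (bigD1 i)//= lerDl sumr_ge0// => j _.
exact: sqr_ge0.
Qed.

(** Two distinct vertices are at positive distance, so shape regularity
    excludes a degenerate volume. *)
Lemma hK_gt0 kappa K : full_simplex K ->
  (forall x y, hull K x -> hull K y -> enorm (x - y) <= kappa * hK K) -> 0 < hK K.
Proof.
move=> fK H; rewrite lt_neqAle powR_ge0 andbT; apply/eqP => /esym h0.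
have /fset0Pn[a aK] : K != fset0 by rewrite -cardfs_gt0 fK.1.
have [b bK /eqP] := full_simplex_other d0 fK aK; apply; apply/rowP => i.
have := H _ _ (hull_vertex bK) (hull_vertex aK); rewrite h0 mulr0.
move=> /(le_trans (ler_coord_enorm _ i)); rewrite normr_le0 !mxE subr_eq0.
by move/eqP.
Qed.

(** The simplex lies in a cube around a vertex, so its measure is finite and
    the definition of hK can be inverted. *)
Lemma leb_hullE kappa K : full_simplex K ->
  (forall x y, hull K x -> hull K y -> enorm (x - y) <= kappa * hK K) ->
  leb d (hull K) = (hK K ^+ d)%:E.
Proof.
move=> fK H.
have fin : leb d (hull K) \is a fin_num.
  rewrite ge0_fin_numE//.
  have /fset0Pn[a aK] : K != fset0 by rewrite -cardfs_gt0 fK.1.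
  have r0 : 0 <= kappa * hK K.
    by apply: le_trans (H _ _ (hull_vertex aK) (hull_vertex aK)); rewrite sqrtr_ge0.
  apply: (@le_lt_trans _ _ ((2 * (kappa * hK K)) ^+ d)%:E); last exact: ltry.
  rewrite -(leb_cube a r0); apply: le_measure; rewrite ?inE.
  - exact: measurable_hull.
  - exact: measurable_cube.
  - move=> x Kx i; apply: le_trans (H _ _ Kx (hull_vertex aK)).
    by have := ler_coord_enorm (x - a) i; rewrite !mxE.
rewrite /hK -powR_mulrn ?powR_ge0// -powRrM mulVf ?pnatr_eq0 -?lt0n// powRr1 ?fineK//.
by rewrite fine_ge0.
Qed.

Lemma leb_open_hull K : full_simplex K -> leb d (open_hull K) = leb d (hull K).
Proof.
move=> fK.
have E : hull K = open_hull K `|` (hull K `\` open_hull K).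
  by rewrite setDUK//; exact: open_hull_hull.
rewrite [in RHS]E measureU.
- by rewrite [X in (_ + X)%E](_ : _ = 0%E) ?adde0//; exact: leb_hullD.
- exact: measurable_open_hull.
- by apply: measurableD; [exact: measurable_hull|exact: measurable_open_hull].
- by rewrite setDE setICA setICr setI0.
Qed.

Lemma lower_bound_seq (I : eqType) (s : seq I) (h : I -> R) :
  (forall i, i \in s -> 0 < h i) ->
  exists2 r, 0 < r & forall i, i \in s -> r <= h i.
Proof.
elim: s => [|i s IH] H; first by exists 1.
have [r r0 rs] : exists2 r, 0 < r & forall i, i \in s -> r <= h i.
  by apply: IH => j js; apply: H; rewrite inE js orbT.
have hi : 0 < h i by apply: H; rewrite inE eqxx.
exists (Num.min r (h i)); first by rewrite lt_min r0.
move=> j; rewrite inE => /orP[/eqP ->|/rs rj]; first by rewrite ge_min lexx orbT.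
by rewrite ge_min rj.
Qed.

Context {Om : set 'rV[R]_d} {T : mesh R d} {kappa : R}.
Context (hT : triangulation Om T).
Context (kappa0 : 0 <= kappa).
Context (hk : shape_regular kappa T).

Let fT K : K \in T -> full_simplex K.
Proof. by case: hT => H _ _ _; exact: H. Qed.

(** By conformity the intersection of K and K' is spanned by their common
    vertices, so it lies where some barycentric coordinate of K vanishes. *)
Lemma open_hull_disjoint K K' x : K \in T -> K' \in T -> K != K' ->
  open_hull K x -> ~ hull K' x.
Proof.
case: hT => _ _ _ HI KT K'T KK' Kx K'x.
have : (hull K `&` hull K') x by split => //; apply: open_hull_hull => //; exact: fT.
rewrite HI// => /(hull_face (fT KT) (fsubsetIl _ _)) [_ H0].
have /fsubsetPn[a aK aK'] : ~~ (K `<=` K')%fset.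
  apply: contra KK' => sKK'; rewrite eqEfcard sKK' /=.
  by rewrite (fT KT).1 (fT K'T).1.
by have := Kx a aK; rewrite H0 ?ltxx// inE aK.
Qed.

(** Volume comparison: for K at z let P K be the image of the interior of K
    under the homothety of centre z and ratio t K = r / hK K <= 1. It has
    volume r^d, lies in the interior of K by convexity, and in the cube of
    half-width kappa r around z by shape regularity. *)
Lemma vertex_degree z : \sum_(K <- T) (z \in K)%:R <= (2 * kappa) ^+ d.
Proof.
have hp K : K \in T -> 0 < hK K by move=> KT; exact: hK_gt0 (fT KT) (hk KT).
have [r r0 rh] := lower_bound_seq hp.
case: (pselect (exists2 K, K \in T & z \in K)) => [[K0 K0T zK0]|nz]; last first.
  rewrite big_seq big1 ?exprn_ge0 ?mulr_ge0// => K KT.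
  case: (boolP (z \in K)) => // zK.
  by case: nz; exists K.
pose t K := r / hK K.
(* f K is the inverse of the homothety. *)
pose f K (x : 'rV[R]_d) := (t K)^-1 *: x + (z - (t K)^-1 *: z).
pose P K : set 'rV[R]_d :=
  if (K \in T) && (z \in K) then f K @^-1` open_hull K else set0.
have tp K : K \in T -> 0 < t K by move=> KT; rewrite divr_gt0// hp.
have t1 K : K \in T -> t K <= 1 by move=> KT; rewrite ler_pdivrMr ?hp// mul1r rh.
have mP K : measurable (P K).
  rewrite /P; case: ifP => // _; rewrite -[X in measurable X]setTI.
  by apply: measurable_affine_rV => //; exact: measurable_open_hull.
have lebP K : K \in T -> leb d (P K) = ((z \in K)%:R * r ^+ d)%:E.
  move=> KT; rewrite /P KT /=; case: ifP => zK; last by rewrite measure0 mul0r.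
  rewrite leb_preimage_homothety ?invr_gt0 ?tp//; last exact: measurable_open_hull.
  rewrite invrK [X in (_ * X)%E](_ : _ = (hK K ^+ d)%:E); last first.
    by rewrite -(leb_hullE (fT KT) (hk KT)); apply: leb_open_hull; exact: fT.
  rewrite -EFinM mul1r.
  by rewrite -exprMn mulfVK// gt_eqF// hp.
have POh K : P K `<=` open_hull K.
  rewrite /P; case: ifP => [/andP[KT zK]|_ x []//] x /= Hx a aK.
  have [c [g E]] := bcoord_affine K a.
  have -> : bcoord K a x = t K * bcoord K a (f K x) + (1 - t K) * bcoord K a z.
    rewrite !E.
    have -> : \sum_j g j * f K x ord0 j =
        (t K)^-1 * (\sum_j g j * x ord0 j)
        + (1 - (t K)^-1) * (\sum_j g j * z ord0 j).
      rewrite !mulr_sumr -big_split /=; apply: eq_bigr => j _; rewrite !mxE.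
      by rewrite mulrDr mulrBr mulrBl mul1r mulrCA (mulrCA (g j)).
    have tn := lt0r_neq0 (tp K KT).
    set A := \sum_j _; set B := \sum_j _.
    by field.
  apply: ltr_wpDr; first by rewrite mulr_ge0 ?subr_ge0 ?t1// (bcoord_vertex (fT KT)).
  by rewrite mulr_gt0 ?tp//; exact: Hx.
pose Q := [set x : 'rV[R]_d | forall i, `|x ord0 i - z ord0 i| <= kappa * r].
have PC K : P K `<=` Q.
  rewrite /P; case: ifP => [/andP[KT zK]|_ x []//] x /= Hx i.
  have := hk KT (open_hull_hull (fT KT) Hx) (hull_vertex zK).
  move=> /(le_trans (ler_coord_enorm _ i)).
  rewrite [X in `|X|](_ : _ = (t K)^-1 * (x ord0 i - z ord0 i)); last first.
    by rewrite !mxE; ring.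
  rewrite normrM ger0_norm ?invr_ge0 ?(ltW (tp K KT))// ler_pdivrMl ?tp//.
  by rewrite mulrCA /t mulfVK// gt_eqF// hp.
have := @le_measure _ _ _ (leb d) (\big[setU/set0]_(K <- T) P K) Q.
rewrite !inE => /(_ (bigsetU_measurable _ (fun i _ => mP i)) (measurable_cube _ _)).
have sub : \big[setU/set0]_(K <- T) P K `<=` Q.
  by rewrite -bigcup_seq => x [K _]; exact: PC.
move=> /(_ sub); rewrite [leRHS](leb_cube z (mulr_ge0 kappa0 (ltW r0))).
rewrite measure_fbigsetU//; last first.
  move=> K K' /= KT K'T [x [Kx K'x]]; apply: contrapT => /eqP KK'.
  apply: (open_hull_disjoint KT K'T KK' (POh _ _ Kx)).
  by apply: open_hull_hull; [exact: fT|exact: POh].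
rewrite big_seq (eq_bigr (fun K => ((z \in K)%:R * r ^+ d)%:E)); last first.
  by move=> K; exact: lebP.
rewrite -big_seq sumEFin lee_fin -mulr_suml mulrA exprMn ler_pM2r//.
by rewrite exprn_gt0.
Qed.

Definition touching K K' : bool := `[< hull K `&` hull K' !=set0 >].

Lemma touching_vertex K K' : K \in T -> K' \in T -> touching K K' ->
  exists2 z, z \in K & z \in K'.
Proof.
case: hT => _ _ _ HI KT K'T /asboolP[x]; rewrite HI// => -[l [_ l1 _]].
have /fset0Pn[z] : (K `&` K')%fset != fset0.
  by apply/eqP => E; move/eqP: l1; rewrite E big_seq_fset0 eq_sym oner_eq0.
by rewrite inE => /andP[]; exists z.
Qed.

Lemma touching_degree K0 : K0 \in T ->
  \sum_(K <- T) (touching K K0)%:R <= d.+1%:R * (2 * kappa) ^+ d.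
Proof.
move=> K0T; apply: (@le_trans _ _ (\sum_(z <- K0) \sum_(K <- T) (z \in K)%:R)).
  rewrite exchange_big big_seq [leRHS]big_seq /=; apply: ler_sum => K KT.
  case: (boolP (touching K K0)) => [tK|_]; last by apply: sumr_ge0.
  have [z zK zK0] := touching_vertex KT K0T tK.
  by rewrite (big_fsetD1 z)//= zK lerDl sumr_ge0.
apply: (@le_trans _ _ (\sum_(z <- K0) (2 * kappa) ^+ d)).
  by apply: ler_sum => z _; exact: vertex_degree.
by rewrite big_const_seq count_predT iter_addr_0 [size _](fT K0T).1 [leRHS]mulr_natl.
Qed.

Definition barycenter F : 'rV[R]_d := \sum_(a <- F) (#|` F|%:R^-1) *: a.

Lemma barycenter_weights F : F != fset0 -> \sum_(a <- F) (#|` F|%:R^-1 : R) = 1.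
Proof.
move=> F0; rewrite big_const_seq count_predT iter_addr_0 -[_ *+ _]mulr_natl.
by rewrite mulfV// pnatr_eq0 cardfs_eq0.
Qed.

Lemma barycenter_hull F : F != fset0 -> hull F (barycenter F).
Proof.
move=> F0; exists (fun=> #|` F|%:R^-1); split => //.
exact: barycenter_weights.
Qed.

(** The barycenter of a face has positive coordinates exactly at the vertices
    of the face, so an element that contains it has all these vertices. A face
    contained in a union of elements is therefore a face of one of them. *)
Lemma face_sub_patch_elt K1 F K'' : K1 \in T -> (F `<=` K1)%fset -> F != fset0 ->
  K'' \in T -> hull K'' (barycenter F) -> (F `<=` K'')%fset.
Proof.
move=> K1T FK1 F0 K''T Hb.
have l1 := barycenter_weights F0; have bF := barycenter_hull F0.
have E := bcoord_comb (fT K1T) FK1 l1 erefl.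
have [b1 _] := hull_face (fT K1T) FK1 bF.
case: hT => _ _ _ HI.
have : (hull K1 `&` hull K'') (barycenter F) by [].
rewrite HI// => /(hull_face (fT K1T) (fsubsetIl _ _)) [_ H0].
apply/fsubsetP => a aF; apply: contrapT => /negP aK''.
have aK1 := fsubsetP FK1 _ aF.
have := H0 a aK1; rewrite inE aK1 /= => /(_ aK'')/eqP.
by rewrite (E a aK1) aF invr_eq0 pnatr_eq0 cardfs_eq0 (negbTE F0).
Qed.

End triangulations.

Section overlap.
Context {R : realType} {d : nat} (d0 : (0 < d)%N).
Context (Om : set 'rV[R]_d) (TH Th : mesh R d) (kappa : R).
Context (kappa0 : 0 <= kappa).
Context (hTH : triangulation Om TH) (hTh : triangulation Om Th).
Context (hkH : shape_regular kappa TH) (hkh : shape_regular kappa Th).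
Context (hr : refines Th TH).

Let M : R := d.+1%:R * (2 * kappa) ^+ d.

(** If the patch of K covers F, some fine element K'' touches K and has F as a
    face. There are at most M such K'', since they all touch K1, and each lies
    in a coarse element, which at most M coarse elements K touch. *)
Lemma patch_overlap (K1 F : simplex R d) :
  K1 \in Th -> (F `<=` K1)%fset -> F != fset0 ->
  \sum_(K <- TH) `[< hull F `<=` elt_patch Th K >]%:R <= M ^+ 2.
Proof.
move=> K1T FK1 F0.
apply: (@le_trans _ _ (\sum_(K <- TH) \sum_(K'' <- Th)
    (touching K'' K1)%:R * (touching K'' K)%:R)).
  apply: ler_sum => K _; case: asboolP => [FD|_]; last first.
    by apply: sumr_ge0 => K'' _; rewrite mulr_ge0.
  have [K'' /= [K''T tK] bK''] := FD _ (barycenter_hull F0).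
  have FK'' := face_sub_patch_elt hTh K1T FK1 F0 K''T bK''.
  have t1 : touching K'' K1.
    apply/asboolP; have /fset0Pn[a aF] := F0.
    by exists a; split; apply: hull_vertex; apply: fsubsetP aF.
  have t2 : touching K'' K by apply/asboolP.
  rewrite (big_fsetD1 K'')//= t1 t2 mul1r lerDl.
  by apply: sumr_ge0 => *; rewrite mulr_ge0.
rewrite exchange_big /= expr2.
apply: (@le_trans _ _ (\sum_(K'' <- Th) (touching K'' K1)%:R * M)); last first.
  rewrite -mulr_suml ler_wpM2r//; last exact: (touching_degree d0 hTh kappa0 hkh K1T).
  by rewrite mulr_ge0// exprn_ge0// mulr_ge0.
rewrite big_seq [leRHS]big_seq; apply: ler_sum => K'' K''T.
rewrite -mulr_sumr ler_wpM2l//.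
have [K0 K0T sub] := hr K''T.
apply: le_trans (touching_degree d0 hTH kappa0 hkH K0T).
apply: ler_sum => K _; case: (boolP (touching K'' K)) => // /asboolP[x [x1 x2]].
suff -> : touching K K0 by [].
by apply/asboolP; exists x; split => //; exact: sub.
Qed.

End overlap.

(** * The inner product of L2 *)

Section null_sets.
Context {dd : measure_display} {T : measurableType dd} {R : realType}.
Context (mu : {measure set T -> \bar R}).

(** An L2(Om) field has arbitrary values outside Om, so on a closed element it
    may fail to be measurable along the boundary. The integral of a nonnegative
    function is a supremum over the simple functions below it, and multiplying
    these by the indicator of E does not change their integral. *)
Lemma ge0_Rintegral_null_set (D E : set T) (f : T -> R) :
  measurable D -> measurable E -> E `<=` D -> mu (D `\` E) = 0%E ->
  (forall x, 0 <= f x) ->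
  \int[mu]_(x in D) f x = \int[mu]_(x in E) f x.
Proof.
move=> mD mE ED null f0; rewrite /Rintegral; congr fine.
have p (S : set T) : (forall x, S x -> 0 <= (f x)%:E)%E.
  by move=> x _; rewrite lee_fin.
rewrite (ge0_integralE _ (p D)) (ge0_integralE _ (p E)).
apply/eqP; rewrite eq_le; apply/andP; split; last first.
  apply: ereal_sup_le => _ [h hE <-]; exists h => //= x.
  apply: le_trans (hE x) _; rewrite /patch; case: ifP => [/set_mem Ex|_].
    by rewrite (mem_set (ED _ Ex)).
  by case: ifP; rewrite ?lee_fin.
apply: ge_ereal_sup => _ [h hD <-].
pose h' : {nnsfun T >-> R} := proj_nnsfun h mE.
apply: (@le_trans _ _ (sintegral mu h')); last first.
  apply: ereal_sup_ubound; exists h' => //= x.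
  rewrite /patch mindicE; case: ifPn => Ex; last by rewrite mulr0.
  rewrite mulr1; move: (hD x); rewrite /patch (mem_set (ED _ (set_mem Ex))).
  by [].
rewrite -!integralT_nnsfun le_eqVlt; apply/orP; left; apply/eqP.
apply: ae_eq_integral => //.
- by apply/measurable_EFinP; exact: measurable_funP.
- by apply/measurable_EFinP; exact: measurable_funP.
exists (D `\` E); split => //; first exact: measurableD.
move=> x /= H; apply: contrapT => nDE; apply: H => _.
rewrite mindicE; congr (_%:E); case: (pselect (E x)) => Ex.
  by rewrite mem_set// mulr1.
have nDx : ~ D x by move=> Dx; apply: nDE.
rewrite memNset//= mulr0; have := hD x; rewrite /patch memNset// lee_fin => hx.
by apply/eqP; rewrite eq_le hx /=; exact: fun_ge0.
Qed.

End null_sets.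

Section L2.
Context {R : realType} {d n q : nat}.
Implicit Types (D : set 'rV[R]_d) (u v w : mfield R d n q).

Lemma L2_mul D v w i j : measurable D -> L2 D v -> L2 D w ->
  (leb d).-integrable D (EFin \o (fun x => v x i j * w x i j)).
Proof.
move=> mD Lv Lw; have [mv iv] := Lv i j; have [mw iw] := Lw i j.
apply: (@le_integrable _ _ _ (leb d) D mD _
  (fun x => ((v x i j ^+ 2)%:E + (w x i j ^+ 2)%:E)%E)) => //.
- by apply/measurable_EFinP; exact: measurable_funM.
- move=> x Dx; rewrite /= lee_fin [leRHS]ger0_norm ?addr_ge0 ?sqr_ge0// ler_norml.
  have := sqr_ge0 (v x i j + w x i j); have := sqr_ge0 (v x i j - w x i j).
  have := sqr_ge0 (v x i j); have := sqr_ge0 (w x i j); nra.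
- exact: integrableD.
Qed.

Lemma integrable_EFin_sum D (I : Type) (s : seq I) (F : I -> 'rV[R]_d -> R) :
  measurable D ->
  (forall i, (leb d).-integrable D (EFin \o F i)) ->
  (leb d).-integrable D (EFin \o (fun x => \sum_(i <- s) F i x)).
Proof.
move=> mD H; rewrite (_ : EFin \o _ = fun x => (\sum_(i <- s) (EFin \o F i) x)%E).
  exact: integrable_sum.
by apply/funext => x /=; rewrite sumEFin.
Qed.

Lemma ip_integrable D v w : measurable D -> L2 D v -> L2 D w ->
  (leb d).-integrable D (EFin \o (fun x => \sum_i \sum_j v x i j * w x i j)).
Proof.
move=> mD Lv Lw; apply: integrable_EFin_sum => // i.
by apply: integrable_EFin_sum => // j; exact: L2_mul.
Qed.

Lemma L2_subspace D : measurable D -> linear_subspace (@L2 R d n q D).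
Proof.
move=> mD; split; [move=> i j|move=> a v w Lv Lw i j].
  rewrite (_ : (fun x => _) = fun=> 0); last by apply/funext => x; rewrite mxE.
  split => //; rewrite (_ : (fun x => _) = fun=> 0%E); last first.
    by apply/funext => x; rewrite mxE expr0n.
  exact: integrable0.
rewrite (_ : (fun x => _) = fun x => a * v x i j + w x i j); last first.
  by apply/funext => x; rewrite !mxE.
split.
  apply: measurable_funD; last exact: (Lw i j).1.
  by apply: measurable_funM => //; exact: (Lv i j).1.
rewrite (_ : (fun x => _) = EFin \o (fun x => a ^+ 2 * (v x i j * v x i j)
    + 2 * a * (v x i j * w x i j) + w x i j * w x i j)); last first.
  by apply/funext => x /=; rewrite !mxE; congr (_%:E); ring.
have iZ (c : R) (f : 'rV[R]_d -> R) : (leb d).-integrable D (EFin \o f) ->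
    (leb d).-integrable D (EFin \o (fun x => c * f x)).
  by move=> H; exact: (integrableZl mD c H).
have iD (f g : 'rV[R]_d -> R) : (leb d).-integrable D (EFin \o f) ->
    (leb d).-integrable D (EFin \o g) ->
    (leb d).-integrable D (EFin \o (fun x => f x + g x)).
  by move=> Hf Hg; exact: (integrableD mD Hf Hg).
apply: (iD _ _ (iD _ _ (iZ (a ^+ 2) _ _) (iZ (2 * a) _ _)) _).
- exact: (L2_mul i j mD Lv Lv).
- exact: (L2_mul i j mD Lv Lw).
- exact: (L2_mul i j mD Lw Lw).
Qed.

Lemma ip_psd D : measurable D -> psd_form (@L2 R d n q D) (ip D).
Proof.
move=> mD; split => [a u v w Lu Lv Lw|u v Lu Lv|u Lu].
- rewrite /ip -RintegralZl//; last exact: ip_integrable.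
  rewrite -RintegralD//; last exact: ip_integrable.
    apply: eq_Rintegral => x _; rewrite mulr_sumr -big_split; apply: eq_bigr => i _.
    rewrite mulr_sumr -big_split; apply: eq_bigr => j _ /=; rewrite !mxE; ring.
  exact: (integrableZl mD a (ip_integrable mD Lu Lw)).
- apply: eq_Rintegral => x _; apply: eq_bigr => i _; apply: eq_bigr => j _.
  by rewrite mulrC.
- apply: Rintegral_ge0 => x _; apply: sumr_ge0 => i _; apply: sumr_ge0 => j _.
  by rewrite -expr2 sqr_ge0.
Qed.

Lemma L2_sub D D' v : measurable D -> measurable D' -> D' `<=` D ->
  L2 D v -> L2 D' v.
Proof.
move=> mD mD' sD Lv i j; have [mv iv] := Lv i j; split.
  exact: (measurable_funS mD sD).
exact: (integrableS mD mD' sD).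
Qed.

Lemma ip_aeq D u v w : measurable D -> L2 D u -> L2 D v -> L2 D w -> aeq D u v ->
  ip D u w = ip D v w.
Proof.
move=> mD Lu Lv Lw uv; rewrite /ip /Rintegral; congr fine.
have mf z : L2 D z ->
    measurable_fun D (EFin \o (fun x => \sum_i \sum_j z x i j * w x i j)).
  by move=> Lz; apply: (measurable_int (leb d)); exact: ip_integrable.
apply: ae_eq_integral => //; [exact: mf|exact: mf|].
by move: uv; apply: filterS => x H Dx; rewrite H.
Qed.

Lemma aeqD D a u v u' v' : aeq D u u' -> aeq D v v' ->
  aeq D (a *: u + v) (a *: u' + v').
Proof.
by apply: filterS2 => x H1 H2 Dx; rewrite !fctE H1// H2.
Qed.

Lemma aeq_sub D D' u v : D' `<=` D -> aeq D u v -> aeq D' u v.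
Proof. by move=> sD; apply: filterS => x H /sD. Qed.

End L2.

(** * Elementwise splitting and finite element spaces *)

Section split.
Context {R : realType} {d : nat} (d0 : (0 < d)%N).
Context (Om : set 'rV[R]_d) (oOm : open Om) (T : mesh R d).
Context (hT : triangulation Om T).
Implicit Types (K : simplex R d).

Let mOm : measurable Om. Proof. exact: open_measurable_rV. Qed.

Lemma triangulation_full K : K \in T -> full_simplex K.
Proof. by case: hT => H _ _ _; exact: H. Qed.

Lemma open_hull_sub K : K \in T -> open_hull K `<=` Om.
Proof.
case: hT => _ _ sub _ KT; apply: subset_trans (sub K KT).
rewrite -open_subsetE; first exact/open_hull_hull/triangulation_full.
exact: open_open_hull.
Qed.

(** Om lies in the union of the closed elements, whose boundaries are null. *)
Lemma open_hull_cover_null :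
  leb d (Om `\` \big[setU/set0]_(K <- T) open_hull K) = 0%E.
Proof.
have mU : measurable (\big[setU/set0]_(K <- T) open_hull K).
  by apply: bigsetU_measurable => K _; exact: measurable_open_hull.
apply: measure_negligible; first exact: measurableD.
apply: (@negligibleS _ _ _ _
    (\big[setU/set0]_(K <- T | K \in T) (hull K `\` open_hull K))).
  move=> x [Omx nU]; case: hT => _ cl _ _.
  have : closure Om x by exact: subset_closure.
  rewrite cl => -[K /= KT Kx]; rewrite -bigcup_seq_cond; exists K; rewrite /= ?KT//.
  by split => // Kx'; apply: nU; rewrite -bigcup_seq; exists K.
elim/big_ind : _ => [|A B|K KT]; [exact: negligible_set0|exact: negligibleU|].
have fK := triangulation_full KT.
apply/negligibleP; last exact: leb_hullD.
by apply: measurableD; [exact: measurable_hull|exact: measurable_open_hull].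
Qed.

Context {n q : nat}.
Implicit Types (v w : mfield R d n q).

Lemma L2_open_hull K v : K \in T -> L2 Om v -> L2 (open_hull K) v.
Proof.
move=> KT; apply: L2_sub => //; first exact: measurable_open_hull.
exact: open_hull_sub.
Qed.

Lemma nrm_hull K v : K \in T -> nrm (hull K) v = nrm (open_hull K) v.
Proof.
move=> KT; have fK := triangulation_full KT.
congr Num.sqrt; apply: ge0_Rintegral_null_set.
- exact: measurable_hull.
- exact: measurable_open_hull.
- exact: open_hull_hull.
- exact: leb_hullD.
- move=> x; apply: sumr_ge0 => i _; apply: sumr_ge0 => j _.
  by rewrite -expr2 sqr_ge0.
Qed.

(** The sum is over interiors, which lie in Om, rather than over the closed
    elements, which need not. *)
Lemma ip_split v w : L2 Om v -> L2 Om w ->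
  ip Om v w = \sum_(K <- T) ip (open_hull K) v w.
Proof.
move=> Lv Lw; pose F x := \sum_i \sum_j v x i j * w x i j.
pose U := \big[setU/set0]_(K <- T) open_hull K.
have mU : measurable U.
  by apply: bigsetU_measurable => K _; exact: measurable_open_hull.
have sU : U `<=` Om by rewrite /U -bigcup_seq => x [K /= KT]; exact: open_hull_sub.
have iF := ip_integrable mOm Lv Lw.
rewrite /ip /Rintegral.
rewrite (@negligible_integral _ _ _ (leb d) _ _ _ (measurableD mOm mU) mOm iF
  open_hull_cover_null).
rewrite setDD setIidr//.
rewrite (@integral_bigsetU_EFin _ _ _ (leb d) _ (@open_hull R d) F T).
- rewrite big_seq -sum_fine -?big_seq// => K KT.
  apply: integrable_fin_num; first exact: measurable_open_hull.
  apply: (integrableS mOm _ (open_hull_sub KT) iF); exact: measurable_open_hull.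
- exact: measurable_open_hull.
- exact: fset_uniq.
- move=> K K' /= KT K'T [x [Kx K'x]]; apply: contrapT => /eqP KK'.
  apply: (open_hull_disjoint hT KT K'T KK' Kx).
  by apply: open_hull_hull => //; exact: triangulation_full.
- by apply: measurable_funS sU (measurable_int _ iF).
Qed.

Lemma fe_subspace (V : set (mfield R d n q)) : fe_space Om T V -> linear_subspace V.
Proof.
move=> [m [b [Lb ->]]]; split => [|a u v [Lu [cu hu]] [Lv [cv hv]]] /=.
  split; first exact: (L2_subspace mOm).1.
  exists (fun=> 0); rewrite big1 => [|l _]; last by rewrite scale0r.
  by apply: nearW.
split; first exact: (L2_subspace mOm).2.
exists (fun l => a * cu l + cv l).
have -> : \sum_l (a * cu l + cv l) *: b l =
    a *: (\sum_l cu l *: b l) + \sum_l cv l *: b l.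
  rewrite scaler_sumr -big_split; apply: eq_bigr => l _ /=.
  by rewrite scalerDl scalerA.
exact: aeqD.
Qed.

Lemma fe_L2 (V : set (mfield R d n q)) : fe_space Om T V -> V `<=` L2 Om.
Proof. by move=> [m [b [Lb ->]]] v []. Qed.

Lemma fe_projection (V : set (mfield R d n q)) u : fe_space Om T V -> L2 Om u ->
  exists2 g, V g & forall v, V v -> ip Om (u - g) v = 0.
Proof.
move=> hV Lu; have sV := fe_subspace hV; have VL := fe_L2 hV.
move: hV => [m [b [Lb E]]].
have sL := @L2_subspace R d n q Om mOm; have fB := @ip_psd R d n q Om mOm.
have Vb l : V (b l).
  rewrite E /=; split; first exact: (Lb l).1.
  exists (fun k => (k == l)%:R); rewrite (bigD1 l)//= eqxx scale1r big1 ?addr0.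
    by apply: nearW.
  by move=> k /negbTE ->; rewrite scale0r.
pose s := [seq b l | l <- enum 'I_m].
have sb c : c \in s -> V c by move=> /mapP[l _ ->].
have [g sg og] := span_projection sL fB (fun c cs => VL _ (sb c cs)) Lu.
have Vg : V g by exact: sg.
exists g => // v Vv; have Lv := VL _ Vv; have Lg := VL _ Vg.
have Lug : L2 Om (u - g) by exact: (subspaceB sL).
move: Vv; rewrite E => -[_ [c hc]].
have [LS S0] : [set v | L2 Om v /\ ip Om (u - g) v = 0] (\sum_l c l *: b l).
  have sA := psd_annihilator sL fB Lug.
  elim/big_ind : _ => [|x y|l _]; [exact: sA.1|exact: subspaceD|].
  apply: subspaceZ => //; split; first exact: (Lb l).1.
  by apply: og; apply: map_f; rewrite mem_enum.
by rewrite (psdC fB)// (ip_aeq mOm Lv LS Lug hc) (psdC fB).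
Qed.

End split.

(** * Local estimate of the pairing *)

Section sums.
Context {R : realType} {I : Type}.

Lemma sum_cauchy_schwarz (s : seq I) (a b : I -> R) :
  \sum_(i <- s) a i * b i <=
  Num.sqrt (\sum_(i <- s) a i ^+ 2) * Num.sqrt (\sum_(i <- s) b i ^+ 2).
Proof.
pose B (u v : I -> R^o) : R := \sum_(i <- s) u i * v i.
have sL : linear_subspace [set: I -> R^o] by [].
have fB : psd_form [set: I -> R^o] B.
  split => [c u v w _ _ _|u v _ _|u _].
  - rewrite /B mulr_sumr -big_split; apply: eq_bigr => i _ /=.
    by rewrite !fctE mulrDl -mulrA.
  - by apply: eq_bigr => i _; rewrite mulrC.
  - by apply: sumr_ge0 => i _; rewrite -expr2 sqr_ge0.
have := psd_cauchy_schwarz sL fB (u := a) (v := b) Logic.I Logic.I.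
have sq u : B u u = \sum_(i <- s) u i ^+ 2 by apply: eq_bigr => i _; rewrite expr2.
by rewrite !sq; apply: le_trans; exact: ler_norm.
Qed.

End sums.

Section estimates.
Context {R : realType} {d n : nat} (d0 : (0 < d)%N).
Context (Om : set 'rV[R]_d) (oOm : open Om) (TH Th : mesh R d).
Context (hTH : triangulation Om TH) (hTh : triangulation Om Th).
Implicit Types (K E : simplex R d).

Let mOm : measurable Om. Proof. exact: open_measurable_rV. Qed.

Lemma sum_refined (F : simplex R d -> R) :
  (forall K, K \in TH -> K \in Th -> F K = 0) ->
  \sum_(K <- TH) F K = \sum_(K <- (TH `\` Th)%fset) F K.
Proof.
move=> F0; rewrite -(big_fset_incl _ (fsubsetDl TH Th))//.
by move=> K KT; rewrite inE KT andbT negbK => /F0; apply.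
Qed.

Lemma local_pairing (g w : mfield R d n 1) (C : R) (b : simplex R d -> R) :
  0 <= C -> L2 Om g -> L2 Om w ->
  (forall K, K \in TH -> K \in Th -> aeq (hull K) w 0) ->
  (forall K, K \in TH -> K \notin Th -> nrm (hull K) w <= C * hK K * b K) ->
  `|ip Om g w| <= C *
    (Num.sqrt (\sum_(K <- (TH `\` Th)%fset) (hK K * nrm (hull K) g) ^+ 2) *
     Num.sqrt (\sum_(K <- (TH `\` Th)%fset) b K ^+ 2)).
Proof.
move=> C0 Lg Lw w0 wb.
have mo K : measurable (open_hull K) by exact: measurable_open_hull.
have Lgo K : K \in TH -> L2 (open_hull K) g.
  by move=> KT; exact: (L2_open_hull oOm hTH).
have Lwo K : K \in TH -> L2 (open_hull K) w.
  by move=> KT; exact: (L2_open_hull oOm hTH).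
rewrite (ip_split d0 oOm hTH)//; apply: (le_trans (ler_norm_sum _ _ _)).
have -> : \sum_(K <- TH) `|ip (open_hull K) g w| =
    \sum_(K <- (TH `\` Th)%fset) `|ip (open_hull K) g w|.
  apply: sum_refined => K KTH KTh.
  have sL := @L2_subspace R d n 1 _ (mo K).
  rewrite (psdC (ip_psd (mo K))); [|exact: Lgo|exact: Lwo].
  have e0 : aeq (open_hull K) w 0.
    apply: aeq_sub (w0 K KTH KTh).
    exact/open_hull_hull/(triangulation_full hTH).
  rewrite (ip_aeq (mo K) (Lwo K KTH) sL.1 (Lgo K KTH) e0).
  rewrite -(scale0r w) (psdZl sL (ip_psd (mo K))) ?mul0r ?normr0//.
    exact: Lwo.
  exact: Lgo.
apply: (@le_trans _ _ (\sum_(K <- (TH `\` Th)%fset)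
    C * ((hK K * nrm (hull K) g) * b K))); last first.
  by rewrite -mulr_sumr ler_wpM2l// sum_cauchy_schwarz.
rewrite big_seq [leRHS]big_seq; apply: ler_sum => K; rewrite inE => /andP[KTh KTH].
have sL := @L2_subspace R d n 1 _ (mo K).
apply: (le_trans (psd_cauchy_schwarz sL (ip_psd (mo K)) (Lgo K KTH) (Lwo K KTH))).
rewrite -/(nrm _ g) -/(nrm _ w) -!(nrm_hull d0 hTH)//.
apply: (le_trans (ler_wpM2l (sqrtr_ge0 _) (wb K KTH KTh))).
by rewrite le_eqVlt; apply/orP; left; apply/eqP; rewrite /nrm; ring.
Qed.

Context (kappa : R) (kappa0 : 0 <= kappa) (hr : refines Th TH).
Context (hkH : shape_regular kappa TH) (hkh : shape_regular kappa Th).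

Lemma face_parent E : E \in faces Th ->
  E != fset0 /\ exists2 K, K \in Th & (E `<=` K)%fset.
Proof.
move=> /imfset2P[K KT [a aK ->]]; split; last by exists K => //; exact: fsubD1set.
have [b bK ba] := full_simplex_other d0 (triangulation_full hTh KT) aK.
by apply/fset0Pn; exists b; rewrite !inE ba.
Qed.

Lemma fint_ge0 E (g : 'rV[R]_d -> R) : (forall x, 0 <= g x) -> 0 <= fint E g.
Proof.
by move=> g0; rewrite mulr_ge0 ?sqrtr_ge0//; apply: Rintegral_ge0 => x _.
Qed.

Lemma hull_closure (K F : simplex R d) : K \in Th -> (F `<=` K)%fset ->
  hull F `<=` closure Om.
Proof.
move=> KT FK x /(hull_face (triangulation_full hTh KT) FK) [Kx _].
by case: hTh => _ -> _ _; exists K.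
Qed.

Lemma sum_fsubset_le (I : choiceType) (A B : {fset I}) (F : I -> R) :
  (A `<=` B)%fset -> (forall i, 0 <= F i) ->
  \sum_(i <- A) F i <= \sum_(i <- B) F i.
Proof.
move=> AB F0.
rewrite (eq_big_seq (fun i => if i \in A then F i else 0)) => [|i /= -> //].
rewrite (big_fset_incl _ AB) => [|i _ /negbTE -> //].
by apply: ler_sum => i _; case: ifP.
Qed.

(** Exchange the sums: each c i is counted once for every K whose patch
    contains hl i. It serves both for the elements and for the faces. *)
Lemma overlap_sum (I : eqType) (s : seq I) (hl : I -> set 'rV[R]_d)
    (c : I -> R) (M : R) :
  (forall i, i \in s -> 0 <= c i) ->
  (forall i, i \in s -> hl i `<=` closure Om) ->
  (forall i, i \in s -> \sum_(K <- TH) `[< hl i `<=` elt_patch Th K >]%:R <= M) ->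
  \sum_(K <- TH) \sum_(i <- s | `[< hl i `<=` elt_patch Th K >]) c i <=
  M * \sum_(i <- s | `[< hl i `<=` closure Om >]) c i.
Proof.
move=> c0 cl hM.
have -> : \sum_(i <- s | `[< hl i `<=` closure Om >]) c i = \sum_(i <- s) c i.
  rewrite big_mkcond big_seq [RHS]big_seq; apply: eq_bigr => i si.
  by case: asboolP => // nsub; case: nsub; exact: cl.
under eq_bigr do rewrite big_mkcond.
rewrite exchange_big /= mulr_sumr big_seq [leRHS]big_seq; apply: ler_sum => i si.
apply: le_trans (ler_wpM2r (c0 i si) (hM i si)).
rewrite mulr_suml; apply: ler_sum => K _.
by case: asboolP => _; rewrite ?mul1r ?mul0r.
Qed.

Lemma norm1h_patch_sum (v : mfield R d n 1) :
  \sum_(K <- (TH `\` Th)%fset) norm1h Th (elt_patch Th K) v ^+ 2 <=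
  (d.+1%:R * (2 * kappa) ^+ d) ^+ 2 * norm1h Th (closure Om) v ^+ 2.
Proof.
set M := d.+1%:R * _.
pose al (K : simplex R d) :=
  \sum_(j < d) nrm (hull K) (classical_op (part_e j) 1 (elt v K)) ^+ 2.
pose be (E : simplex R d) := (hE E)^-1 * fnrm2 E (jump Th (elt v) E).
have al0 K : 0 <= al K by apply: sumr_ge0 => j _; exact: sqr_ge0.
have be0 E : 0 <= be E.
  rewrite mulr_ge0 ?invr_ge0 ?powR_ge0//; apply: fint_ge0 => x.
  by apply: sumr_ge0 => i _; apply: sumr_ge0 => j _; exact: sqr_ge0.
have nE G : norm1h Th G v ^+ 2 = \sum_(K <- Th | `[< hull K `<=` G >]) al K
    + \sum_(E <- faces Th | `[< hull E `<=` G >]) be E.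
  rewrite sqr_sqrtr//; apply: addr_ge0; apply: sumr_ge0 => i _.
    exact: al0.
  exact: be0.
apply: (@le_trans _ _ (\sum_(K <- TH) norm1h Th (elt_patch Th K) v ^+ 2)).
  exact: sum_fsubset_le (fsubsetDl _ _) (fun K => sqr_ge0 _).
under eq_bigr do rewrite nE.
rewrite nE big_split /= mulrDr; apply: lerD; apply: overlap_sum => //.
- by move=> K KT; exact: hull_closure (fsubset_refl K).
- move=> K KT; apply: (patch_overlap d0 kappa0 hTH hTh hkH hkh hr KT) => //.
  by rewrite -cardfs_gt0 (triangulation_full hTh KT).1.
- by move=> E /face_parent[_ [K KT EK]]; exact: hull_closure KT EK.
- move=> E /face_parent[E0 [K KT EK]].
  exact: (patch_overlap d0 kappa0 hTH hTh hkH hkh hr KT).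
Qed.

End estimates.

(** * The error equation and quasi-orthogonality *)

Section pairing.
Context {R : realType} {d n : nat}.
Context (Om : set 'rV[R]_d) (oOm : open Om).
Context (A : mfield R d n d -> mfield R d n d).
Context (Sigma : set (mfield R d n d)) (X : discretization R d n).

Let mOm : measurable Om. Proof. exact: open_measurable_rV. Qed.

Lemma stress_L2 : stress_space Om Sigma -> Sigma `<=` L2 Om.
Proof. by move=> [->|[_ ->]] t; [case|case; case]. Qed.

Lemma energy_psd : bounded_sym_psd Om A ->
  psd_form (L2 Om) (fun s t => ip Om (A s) t).
Proof.
move=> [AL lA _ sA pA]; split => // [a u v w Lu Lv Lw|u v Lu Lv].
  have sL := @L2_subspace R d n d _ mOm.
  have [lI _ _] := @ip_psd R d n d _ mOm.
  have Lc : L2 Om (a *: A u + A v) by apply: sL.2; exact: AL.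
  rewrite (ip_aeq mOm (AL _ (sL.2 a u v Lu Lv)) Lc Lw (lA a u v Lu Lv)).
  by apply: lI => //; exact: AL.
by rewrite sA// (psdC (ip_psd mOm))//; exact: AL.
Qed.

Context (hSigma : stress_space Om Sigma) (hA : bounded_sym_psd Om A).
Context (CA : R).
Context (hCA : forall t, Sigma t -> ip Om (A t) t <= CA * nrm Om t ^+ 2).

Context (f u : mfield R d n 1) (s : mfield R d n d) (Lf : L2 Om f).
Context (ex : exact_solution Om A Sigma f s u).
Context (TH Th : mesh R d).
Context (feU : fe_space Om Th (U_h X Th)).
Context (feUH : fe_space Om TH (U_h X TH)).
Context (SS : Sigma_h X Th `<=` Sigma) (SHh : Sigma_h X TH `<=` Sigma_h X Th).
Context (UHh : U_h X TH `<=` U_h X Th).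
Context (divh : forall t, Sigma_h X Th t -> U_h X Th (wdiv Om t)).
Context (divH : forall t, Sigma_h X TH t -> U_h X TH (wdiv Om t)).
Context (sh : mfield R d n d) (uh : mfield R d n 1).
Context (dh : discrete_solution Om A X Th f sh uh).

Let SL : Sigma `<=` L2 Om := stress_L2 hSigma.
Let fA := energy_psd hA.
Let sLS := @L2_subspace R d n d Om mOm.
Let sLU := @L2_subspace R d n 1 Om mOm.
Let fU := @ip_psd R d n 1 Om mOm.
Let UL : U_h X Th `<=` L2 Om := fe_L2 feU.
Let sU := fe_subspace oOm feU.
Let Ls : L2 Om s. Proof. by apply: SL; case: ex. Qed.
Let Lu : L2 Om u. Proof. by case: ex. Qed.
Let Ssh : Sigma_h X Th sh. Proof. by case: dh. Qed.
Let Lsh : L2 Om sh. Proof. exact/SL/SS. Qed.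

Lemma nrmA_sqr t : L2 Om t -> nrmA Om A t ^+ 2 = ip Om (A t) t.
Proof. by move=> Lt; rewrite sqr_sqrtr//; case: fA => _ _; apply. Qed.

Lemma error_equation t : Sigma_h X Th t ->
  ip Om (A (s - sh)) t = ip Om (wdiv Om t) u - ip Om (wdiv Om t) uh.
Proof.
move=> St; have Lt := SL (SS St).
have := psdBl fA Ls Lsh Lt => /= ->.
have [_ _ e1 _] := ex; have [_ _ e2 _] := dh.
have /eqP := e1 t (SS St); have /eqP := e2 t St.
by rewrite !subr_eq0 => /eqP -> /eqP ->.
Qed.

(** For v = Pu - uh the hypothesis on v is the defining property of the
    projection; the error equation then turns every quotient of the supremum
    into (A (s - sh), t) / |t|. *)
Lemma inf_sup_error C v :
  (forall g, U_h X Th g -> ip Om g v = ip Om g u - ip Om g uh) ->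
  0 <= C ->
  norm1h Th (closure Om) v <=
    C * sup [set ip Om (wdiv Om t) v / nrm Om t
              | t in [set t | Sigma_h X Th t /\ nrm Om t != 0]] ->
  norm1h Th (closure Om) v <= C * (Num.sqrt CA * nrmA Om A (s - sh)).
Proof.
move=> hv C0 /le_trans; apply; apply: ler_wpM2l => //.
set S := [set _ | _ in _].
have b0 : 0 <= Num.sqrt CA * nrmA Om A (s - sh).
  by rewrite mulr_ge0// sqrtr_ge0.
have [->|S0] := eqVneq S set0; first by rewrite sup0.
apply: ge_sup; first exact/set0P.
move=> _ [t /= [St tn] <-].
have tp : 0 < nrm Om t by rewrite lt_neqAle eq_sym tn sqrtr_ge0.
rewrite ler_pdivrMr// hv; last exact: divh.
rewrite -error_equation//; apply: (le_trans (ler_norm _)).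
have Lt := SL (SS St); have Lsd := subspaceB sLS Ls Lsh.
apply: (le_trans (psd_cauchy_schwarz sLS fA Lsd Lt)).
rewrite -/(nrmA _ _ _) [leRHS]mulrAC [leRHS]mulrC ler_wpM2l ?sqrtr_ge0//.
apply: (@le_trans _ _ (Num.sqrt (CA * nrm Om t ^+ 2))).
  by rewrite ler_wsqrtr//; apply: hCA; exact: SS.
case: (leP 0 CA) => cA; first by rewrite sqrtrM// sqrtr_sqr ger0_norm// ltW.
rewrite ler0_sqrtr; first by rewrite mulr_ge0 ?sqrtr_ge0// ltW.
by rewrite mulr_le0_ge0 ?sqr_ge0// ltW.
Qed.

Context (sH : mfield R d n d) (uH : mfield R d n 1).
Context (dH : discrete_solution Om A X TH f sH uH).

Let SsH : Sigma_h X TH sH. Proof. by case: dH. Qed.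
Let LsH : L2 Om sH. Proof. exact/SL/SS/SHh. Qed.

Lemma l2projP (g := l2proj Om (U_h X TH) f) :
  U_h X TH g /\ forall v, U_h X TH v -> ip Om (f - g) v = 0.
Proof.
rewrite /g /l2proj; case: xgetP => [g' _ //|N].
by have [w Uw ow] := fe_projection oOm feUH Lf; case: (N w).
Qed.

(** [wdiv] selects a representative of the weak divergence of each field, so
    wdiv (sh - sH) and wdiv sh - wdiv sH need not be equal as fields. The error
    equation is therefore applied to sh and sH separately and subtracted, its
    left-hand side being linear. *)
Lemma pairing_oscillation v w :
  U_h X Th v -> (forall g, U_h X Th g -> ip Om g v = ip Om g u - ip Om g uh) ->
  U_h X TH w ->
  ip Om (A (s - sh)) (sh - sH) = ip Om (f - l2proj Om (U_h X TH) f) (v - w).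
Proof.
move=> Uv hv Uw.
have [_ _ _ ehf] := dh; have [_ _ _ eHf] := dH.
have UHL : U_h X TH `<=` L2 Om := fe_L2 feUH.
have Lse : L2 Om (s - sh) := subspaceB sLS Ls Lsh.
have Dh := divh Ssh; have DH := divH SsH.
have Ldh := UL Dh; have LdH := UHL _ DH.
have Lv := UL Uv; have Lw := UHL _ Uw.
have Lvw := subspaceB sLU Lv Lw.
have e1 : ip Om (A (s - sh)) (sh - sH) =
    ip Om (wdiv Om sh) v - ip Om (wdiv Om sH) v.
  have := psdBr sLS fA Lsh LsH Lse => /= ->.
  rewrite !error_equation//; last exact: SHh.
  by rewrite !hv//; exact: UHh.
have [UfH ofH] := l2projP; set fH := l2proj Om (U_h X TH) f in UfH ofH *.
have LfH := UHL _ UfH.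
have gw : ip Om (wdiv Om sh) w = ip Om (wdiv Om sH) w.
  by rewrite ehf ?eHf//; exact: UHh.
(* div sH and fH are both projections of f on the coarse space, hence equal
   almost everywhere. *)
have e2 : ip Om (wdiv Om sH) (v - w) = ip Om fH (v - w).
  have Ue : U_h X TH (wdiv Om sH - fH).
    exact: (subspaceB (fe_subspace oOm feUH) DH UfH).
  have Le := UHL _ Ue.
  have ee : ip Om (wdiv Om sH - fH) (wdiv Om sH - fH) = 0.
    have := ofH _ Ue; rewrite (psdBl fU Lf LfH Le) => oe.
    by rewrite (psdBl fU LdH LfH Le) eHf.
  have := psd_cauchy_schwarz sLU fU Le Lvw.
  by rewrite ee sqrtr0 mul0r normr_le0 (psdBl fU LdH LfH Lvw) subr_eq0 => /eqP.
rewrite e1 (psdBl fU Lf LfH Lvw) -e2.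
have Uvw : U_h X Th (v - w) := subspaceB sU Uv (UHh Uw).
rewrite -(ehf _ Uvw).
apply: (etrans _ (esym (congr2 (fun a b : R => a - b)
  (psdBr sLU fU Lv Lw Ldh) (psdBr sLU fU Lv Lw LdH)))).
by rewrite gw opprB addrA addrNK.
Qed.

End pairing.

(** Young's inequality: 2 C q c <= delta q^2 + C^2 c^2 / delta. It stands for
    a = |s - sh|^2, b = |sh - sH|^2, y = |s - sH|^2 in the energy norm, with x
    the mixed term and c the oscillation. *)
Lemma quasi_orthogonality_algebra (R : realType) (a b c x y q C : R) :
  y = a + b + 2 * x -> `|x| <= C * q * c -> 0 <= C -> a = q ^+ 2 ->
  forall delta, 0 < delta ->
  (1 - delta) * a <= y - b + C ^+ 2 / delta * c ^+ 2.
Proof.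
move=> -> hx C0 -> delta delta0.
have h : - (2 * x) <= delta * q ^+ 2 + C ^+ 2 / delta * c ^+ 2.
  apply: (@le_trans _ _ (2 * (C * q * c))).
    by rewrite -mulrN ler_pM2l// (le_trans _ hx)// ler_normr lexx orbT.
  rewrite -subr_ge0 (_ : _ - _ = delta^-1 * (delta * q - C * c) ^+ 2); last first.
    by field; rewrite gt_eqF.
  by rewrite mulr_ge0 ?invr_ge0 ?sqr_ge0// ltW.
by move: h; rewrite mulrBl mul1r; lra.
Qed.

Theorem theorem3p3 (R : realType) (d n : nat) (hd : d = 2%N \/ d = 3%N)
    (hn : (0 < n)%N)
    (Om : set 'rV[R]_d) (hOm : admissible_domain Om)
    (Sigma : set (mfield R d n d)) (hSigma : stress_space Om Sigma)
    (A : mfield R d n d -> mfield R d n d)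
    (hA : bounded_sym_psd Om A) (hAc : coercive Om A Sigma)
    (X : discretization R d n)
    (hmeshes : admissible_meshes Om X) (hspaces : admissible_spaces Om A Sigma X)
    (hincl : inclusion Om X)
    (hinfsup : discrete_inf_sup Om X)
    (happrox : local_approximation X)
    (hcurl : curl_decomposition Om A X)
    (hpost : a_posteriori Om A Sigma X) :
  exists2 C0 : R, 0 < C0 &
  forall f : mfield R d n 1, L2 Om f ->
  forall (s : mfield R d n d) (u : mfield R d n 1),
    exact_solution Om A Sigma f s u ->
  forall TH Th : mesh R d, nested X TH Th ->
  forall (sh : mfield R d n d) (uh : mfield R d n 1),
    discrete_solution Om A X Th f sh uh ->
  forall (sH : mfield R d n d) (uH : mfield R d n 1),
    discrete_solution Om A X TH f sH uH ->
  ip Om (A (s - sh)) (sh - sH)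
    <= Num.sqrt C0 * nrmA Om A (s - sh) * osc Om (U_h X TH) f (TH `\` Th)%fset
  /\
  forall delta : R, 0 < delta ->
    (1 - delta) * nrmA Om A (s - sh) ^+ 2
      <= nrmA Om A (s - sH) ^+ 2 - nrmA Om A (sh - sH) ^+ 2
         + C0 / delta * osc Om (U_h X TH) f (TH `\` Th)%fset ^+ 2.
Proof.
have d0 : (0 < d)%N by case: hd => ->.
have oOm : open Om by case: hOm => -[].
have mOm := open_measurable_rV oOm.
have [CA CA0 hCA] := hAc.
have hCA' t : Sigma t -> ip Om (A t) t <= CA * nrm Om t ^+ 2.
  by move=> /hCA[/andP[]].
have [Ci Ci0 hCi] := hinfsup.
have [Cs Cs0 hCs] := happrox.
have [htri [kap hkap]] := hmeshes.
(* Without any mesh the shape constant could be negative. *)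
pose kappa := Num.max kap 0.
have kappa0 : 0 <= kappa by rewrite le_max lexx orbT.
have hkappa T : meshes X T -> shape_regular kappa T.
  move=> XT K KT x y Kx Ky; apply: (le_trans (hkap T XT K KT x y Kx Ky)).
  by rewrite ler_wpM2r ?powR_ge0// le_max lexx.
have [hfe _ hUn _] := hspaces.
have [hSn hdiv] := hincl.
pose M : R := d.+1%:R * (2 * kappa) ^+ d.
have M0 : 0 <= M by rewrite mulr_ge0// exprn_ge0// mulr_ge0.
(* The summand 1 makes C positive. *)
pose C := Cs * (M * (Ci * Num.sqrt CA)) + 1.
have C00 : 0 <= Cs * (M * (Ci * Num.sqrt CA)).
  by apply: mulr_ge0 (ltW Cs0) (mulr_ge0 M0 (mulr_ge0 (ltW Ci0) (sqrtr_ge0 _))).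
have C0 : 0 < C by rewrite ltr_wpDl.
exists (C ^+ 2); first by rewrite exprn_gt0.
move=> f Lf s u ex TH Th nest sh uh dh sH uH dH.
have [XTH XTh hr] := nest.
have [_ SS feU _ _] := hfe Th XTh; have [_ _ feUH _ _] := hfe TH XTH.
have hTh := htri Th XTh; have hTH := htri TH XTH.
have SHh := hSn TH Th nest; have UHh := hUn TH Th nest.
have SL := stress_L2 hSigma.
have fA := energy_psd oOm hA.
have sLS := @L2_subspace R d n d Om mOm.
have fU := @ip_psd R d n 1 Om mOm.
have Ls : L2 Om s by apply: SL; case: ex.
have Lu : L2 Om u by case: ex.
have Lsh : L2 Om sh by apply/SL/SS; case: dh.
have LsH : L2 Om sH by apply/SL/SS/SHh; case: dH.
have Uuh : U_h X Th uh by case: dh.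
have UL := fe_L2 feU.
have [pu Upu opu] := fe_projection oOm feU Lu.
pose v := pu - uh.
(* Elements of the fine space do not see the difference of u and pu. *)
have Uv : U_h X Th v := subspaceB (fe_subspace oOm feU) Upu Uuh.
have hv g : U_h X Th g -> ip Om g v = ip Om g u - ip Om g uh.
  move=> Ug; have Lg := UL _ Ug; have Lpu := UL _ Upu; have Luh := UL _ Uuh.
  have sLU := @L2_subspace R d n 1 Om mOm.
  rewrite (psdBr sLU fU Lpu Luh Lg); congr (_ - _).
  have := opu g Ug; rewrite (psdBl fU Lu Lpu Lg) => /eqP; rewrite subr_eq0 => /eqP.
  by rewrite (psdC fU Lg Lpu) (psdC fU Lg Lu).
have [S hS] := hCs TH Th nest.
have [USv Seq Sloc] := hS v Uv.
have LSv : L2 Om (S v) := fe_L2 feUH USv.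
have pair := pairing_oscillation oOm hSigma hA Lf ex feU feUH SS SHh UHh
  (hdiv Th XTh) (hdiv TH XTH) dh dH Uv hv USv.
set o := osc Om (U_h X TH) f (TH `\` Th)%fset.
have [UfH _] := l2projP oOm Lf feUH.
have main : `|ip Om (A (s - sh)) (sh - sH)| <= C * nrmA Om A (s - sh) * o.
  rewrite pair.
  have sLU := @L2_subspace R d n 1 Om mOm.
  apply: (le_trans (local_pairing d0 oOm hTH (C := Cs)
    (b := fun K => norm1h Th (elt_patch Th K) v) (Th := Th) (ltW Cs0) _ _ _ _)).
  - by apply: (subspaceB sLU) => //; exact: (fe_L2 feUH).
  - by apply: (subspaceB sLU) => //; exact: UL.
  - move=> K KTH KTh; have := Seq K KTH KTh; apply: filterS => x H Kx.
    by rewrite !fctE H// subrr.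
  - exact: Sloc.
  rewrite -/(osc Om (U_h X TH) f _) -/o.
  have o0 : 0 <= o by exact: sqrtr_ge0.
  have q0 : 0 <= nrmA Om A (s - sh) by exact: sqrtr_ge0.
  have n1 := norm1h_patch_sum d0 hTH hTh kappa0 hr
    (hkappa _ XTH) (hkappa _ XTh) v.
  have n2 := inf_sup_error oOm hSigma hA hCA' ex SS (hdiv Th XTh) dh hv
    (ltW Ci0) (hCi Th XTh v Uv).
  have n3 : Num.sqrt (\sum_(K <- (TH `\` Th)%fset)
      norm1h Th (elt_patch Th K) v ^+ 2) <=
      M * (Ci * (Num.sqrt CA * nrmA Om A (s - sh))).
    apply: (@le_trans _ _ (M * norm1h Th (closure Om) v)); last first.
      by rewrite ler_wpM2l.
    have p0 : 0 <= M * norm1h Th (closure Om) v.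
      by rewrite mulr_ge0 ?sqrtr_ge0.
    by rewrite -(ger0_norm p0) -sqrtr_sqr ler_wsqrtr// exprMn.
  apply: (@le_trans _ _
    (Cs * (o * (M * (Ci * (Num.sqrt CA * nrmA Om A (s - sh))))))).
    by rewrite ler_wpM2l ?(ltW Cs0)// ler_wpM2l.
  rewrite (_ : Cs * _ =
    Cs * (M * (Ci * Num.sqrt CA)) * nrmA Om A (s - sh) * o); last by ring.
  by rewrite ler_wpM2r// ler_wpM2r// lerDl.
split.
  by rewrite sqrtr_sqr (gtr0_norm C0); exact: le_trans (ler_norm _) main.
have Lse := subspaceB sLS Ls Lsh; have Lsd := subspaceB sLS Lsh LsH.
have LsHe := subspaceB sLS Ls LsH.
apply: quasi_orthogonality_algebra main (ltW C0) _; last by [].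
rewrite !nrmA_sqr//.
have -> : s - sH = (s - sh) + (sh - sH) by rewrite addrA subrK.
have Lsum : L2 Om (s - sh + (sh - sH)) := subspaceD sLS Lse Lsd.
have := psdDl fA Lse Lsd Lsum => /= ->.
have := psdC fA Lse Lsum => /= ->; have := psdC fA Lsd Lsum => /= ->.
have := psdDl fA Lse Lsd Lse => /= ->; have := psdDl fA Lse Lsd Lsd => /= ->.
by have := psdC fA Lsd Lse => /= ->; ring.
Qed.
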